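(* Suppose that $n^{-2/3}\ll p\ll n^{-3/5}$ and $q\ll n^{-3}p^{-7/2}$, and let $G_1\sim G_{n,p}$ and $G_2\sim G_{n,q}$ be independent. Then a.a.s. there is a $G_1$-measurable colouring $\varphi\colon E(G_1)\to\{\mathrm{red},\mathrm{blue}\}$ that can a.a.s. be extended to a colouring of $E(G_1\cup G_2)$ with no monochromatic triangle.
   Context: $G_{n,p}$ is the binomial random graph on $[n]$ with edge probability $p$. A.a.s. means with probability tending to $1$ as $n\to\infty$. $f\ll g$ means $f/g\to 0$. A colouring of $G_1$ is $G_1$-measurable if it is a function of $G_1$ alone (chosen without knowledge of $G_2$). Extending $\varphi$ means colouring $E(G_1\cup G_2)$ so that the colouring agrees with $\varphi$ on $E(G_1)$. *)

(* Defs.v *)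
From HB Require Import structures.
From mathcomp Require Import all_boot all_order all_algebra.
From mathcomp Require Import all_classical all_reals all_analysis.

Set Implicit Arguments.
Unset Strict Implicit.
Unset Printing Implicit Defensive.

Import Order.TTheory GRing.Theory Num.Theory.
Import numFieldNormedType.Exports.

Local Open Scope ring_scope.
Local Open Scope classical_set_scope.

(* Since division is total (x / 0 = 0), "f / g tends to 0" only has its usual
   meaning when g is eventually nonzero; this is made part of f << g. *)
Definition much_less (R : realType) (f g : nat -> R) : Prop :=
  (\forall n \near \oo, g n != 0) /\ f n / g n @[n --> \oo] --> (0 : R).

Definition pairs (n : nat) : {set {set 'I_n}} :=
  [set e : {set 'I_n} | #|e| == 2]%SET.

(* A graph on the vertex set 'I_n is identified with its edge set. *)
Definition graph (n : nat) : predArgType :=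
  {E : {set {set 'I_n}} | E \subset pairs n}.

Definition edges (n : nat) (G : graph n) : {set {set 'I_n}} := val G.

Definition gnp_weight (R : realType) (n : nat) (p : R) (G : graph n) : R :=
  \prod_(e in pairs n) (if e \in edges G then p else 1 - p).

(* The probability that the binomial random graph G_{n,p} satisfies A. *)
Definition gnp_pr (R : realType) (n : nat) (p : R) (A : pred (graph n)) : R :=
  \sum_(G : graph n | A G) gnp_weight p G.

(* Red is [true] and blue is [false].  Colourings of an edge set E are
   represented by total functions, of which only the values on E matter. *)
Definition colouring (n : nat) : predArgType := {ffun {set 'I_n} -> bool}.

(* If E only contains pairs, then x, y and z are automatically distinct. *)
Definition mono_triangle (n : nat) (E : {set {set 'I_n}}) (psi : colouring n)
    (x y z : 'I_n) : bool :=
  [&& [set x; y]%SET \in E, [set x; z]%SET \in E, [set y; z]%SET \in E,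
      psi [set x; y]%SET == psi [set x; z]%SET
    & psi [set x; y]%SET == psi [set y; z]%SET].

Definition no_mono_triangle (n : nat) (E : {set {set 'I_n}})
    (psi : colouring n) : bool :=
  [forall x, forall y, forall z, ~~ mono_triangle E psi x y z].

Definition extendable (n : nat) (G1 G2 : graph n) (phi : colouring n) : bool :=
  [exists psi : colouring n,
     [forall e in edges G1, psi e == phi e]
     && no_mono_triangle (edges G1 :|: edges G2)%SET psi].

(* Main.v *)
(* In the given range of p and q, a monomial n^v p^a q^b with v > 0 tends to 0 as
   soon as 3v <= 2(a+b) and 10v <= 6a+9b, so a.a.s. no boundedly many
   vertices span a copy of such a dense pattern in (G1, G2).

   Colour one edge of every triangle of G1 blue and all other edges red.  The
   colouring cannot be extended to an edge xy of G2 if xy closes both a blue and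
   a red path of length 2 in G1.  Such a 4-cycle with triangles on two adjacent
   edges puts the triangles in conflict; attaching a further conflict to a
   triangle costs a factor n^3 p^5 = o(1), which is where p << n^(-3/5) enters.
   Peeling off the triangles having an edge that is in conflict with no remaining
   triangle, all conflicts are avoided except inside a stuck set of triangles.
   From a conflict inside the stuck set one can walk from triangle to triangle in
   both directions, and a walk can only stop by closing up on itself; each end
   saves a power of n, so the expected number of such structures, summed over all
   lengths as a geometric series, is o(1) after multiplication by q.  Triangles in
   clusters of at least three are too rare to matter for this and are coloured by
   any colouring of G1 without monochromatic triangles.

   Once every single edge of G2 can be coloured, a minimal set of edges of G2
   to which the colouring does not extend spans at most 5 vertices, and the
   monochromatic triangles obstructing it complete it to a dense pattern; the
   critical one has 6 vertices, 7 edges of G1 and 2 edges of G2. *)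
Require Import Defs.
From mathcomp Require Import all_boot zify boolp.

Set Implicit Arguments.
Unset Strict Implicit.
Unset Printing Implicit Defensive.

(** * Sparse graphs and colourings *)

(** The colouring is fixed before G2 is seen, so conflicts are charged to all non-adjacent pairs xy,
    and stuck sets of triangles in G1 are not ruled out; what is rare is a conflict between two
    stuck triangles whose pair xy is an edge of G2. The count is tightest at p = n^(-3/5), q =
    n^(-3) p^(-7/2) = n^(-9/10). There two triangles in conflict over an edge of G2 have weight n^6
    p^8 q = n^(3/10), a step of the walk is neutral, and a walk ends with a factor p = n^(-3/5) (an
    edge between known vertices), n^2 p^4 = n^(-2/5) (two new vertices, four edges) or n p^2 =
    n^(-1/5) (one new vertex, two edges). Only the last saving is too small, and only then is a
    second walk, from the other triangle, needed. If both triangles share an edge, the start has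
    weight n^(1/10) and any single ending suffices.

    The deterministic part reduces extendability to the absence of finitely described witness pairs
    (A, B), with A in G1 and B in G2. A first moment bound for the pair (G1, G2) and Markov's
    inequality then give the nested a.a.s. statement. *)

Section Graphs.
Variable T : finType.
Implicit Types (E F A B D : {set {set T}}) (U W N t e : {set T}) (x y z u v w a b : T).

Lemma eq_set2 a b x y :
  ([set a; b] == [set x; y]) = (a == x) && (b == y) || (a == y) && (b == x).
Proof.
apply/eqP/orP => [H|[]/andP[/eqP-> /eqP->] //]; last exact: setUC.
have Ha : a \in [set x; y] by rewrite -H set21.
have Hb : b \in [set x; y] by rewrite -H set22.
have Hx : x \in [set a; b] by rewrite H set21.
have Hy : y \in [set a; b] by rewrite H set22.
move: Ha Hb Hx Hy; rewrite !inE => /orP[]/eqP-> /orP[]/eqP->;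
  rewrite !eqxx ?orbb ?orbT ?andbT /=; try by [left|right].
- by move=> _ /eqP->; rewrite eqxx; left.
- by move=> /eqP-> _; rewrite eqxx; left.
Qed.

Lemma cards3 x y z : x != y -> x != z -> y != z -> #|[set x; y; z]| = 3.
Proof.
by move=> xy xz yz; rewrite setUC cardsU1 cards2 xy !inE negb_or !(eq_sym z) xz yz.
Qed.

Definition induced E U := [set e in E | e \subset U].

Definition esize E U := #|induced E U|.

Definition is_graph E := forall e, e \in E -> #|e| = 2.

Lemma graph_neq E x y : is_graph E -> [set x; y] \in E -> x != y.
Proof. by move=> gE /gE; rewrite cards2; case: eqP. Qed.

Lemma is_graphS E F : E \subset F -> is_graph F -> is_graph E.
Proof. by move=> /subsetP sEF gF e /sEF /gF. Qed.

Lemma mem_induced E U x y :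
  ([set x; y] \in induced E U) = [&& [set x; y] \in E, x \in U & y \in U].
Proof. by rewrite inE subUset !sub1set. Qed.

Lemma induced_subl E F U : E \subset F -> induced E U \subset induced F U.
Proof.
by move=> /subsetP s; apply/subsetP => e; rewrite !inE => /andP[/s-> ->].
Qed.

Lemma esize_add E U u N : u \notin U -> N \subset U ->
  (forall x, x \in N -> [set u; x] \in E) ->
  esize E U + #|N| <= esize E (u |: U).
Proof.
move=> uU NU NE.
have inj : {in N &, injective (fun x => [set u; x])}.
  move=> x y xN yN /eqP; rewrite eq_set2 eqxx /= => /orP[/eqP //|/andP[/eqP e1 /eqP e2]].
  by rewrite e2 e1.
rewrite /esize -(card_in_imset inj) -cardsUI.
have -> : induced E U :&: [set [set u; x] | x in N] = set0.
  apply/setP => e; rewrite !inE; apply/negP => /andP[/andP[_ eU] /imsetP[x _ ee]].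
  by move: eU; rewrite ee subUset !sub1set (negPf uU).
rewrite cards0 addn0; apply/subset_leq_card/subsetP => e.
rewrite !inE => /orP[/andP[-> eU]|/imsetP[x xN ->]].
  by rewrite (subset_trans eU) ?subsetUr.
by have xU := subsetP NU x xN; rewrite (NE x xN) subUset !sub1set !inE eqxx xU orbT.
Qed.

Lemma esize_add1 E U u x : u \notin U -> x \in U -> [set u; x] \in E ->
  esize E U + 1 <= esize E (u |: U).
Proof.
move=> uU xU h; rewrite -(cards1 x); apply: esize_add => //.
  by rewrite sub1set.
by move=> y; rewrite inE => /eqP->.
Qed.

Lemma esize_add2 E U u x y : u \notin U -> x \in U -> y \in U -> x != y ->
  [set u; x] \in E -> [set u; y] \in E ->
  esize E U + 2 <= esize E (u |: U).
Proof.
move=> uU xU yU xy hx hy.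
have <- : #|[set x; y]| = 2 by rewrite cards2 xy.
apply: esize_add => //; first by rewrite subUset !sub1set xU.
by move=> w; rewrite !inE => /orP[]/eqP->.
Qed.

Lemma esize_add3 E U u x y z : u \notin U -> x \in U -> y \in U -> z \in U ->
  x != y -> x != z -> y != z ->
  [set u; x] \in E -> [set u; y] \in E -> [set u; z] \in E ->
  esize E U + 3 <= esize E (u |: U).
Proof.
move=> uU xU yU zU xy xz yz hx hy hz.
rewrite -(cards3 xy xz yz).
apply: esize_add => //; first by rewrite !subUset !sub1set xU yU.
by move=> w; rewrite !inE => /orP[/orP[]|]/eqP->.
Qed.

(* The two inequalities say that n^v p^a q^b is bounded for q = n^(-3) p^(-7/2)
   at the two extreme points p = n^(-2/3) and p = n^(-3/5). *)
Definition too_dense (v a b : nat) : bool :=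
  [&& 0 < v, 3 * v <= 2 * (a + b) & 10 * v <= 6 * a + 9 * b].

(** Nine is the first size at which triangles glued along edges, with v vertices and 2v - 3 edges,
    become too dense: 10 * 9 = 6 * 15. *)
Definition sparse E F :=
  forall U, #|U| <= 9 -> ~~ too_dense #|U| (esize E U) (esize F U).

Definition triangle E x y z :=
  [&& [set x; y] \in E, [set x; z] \in E & [set y; z] \in E].

Definition mono_free E (psi : {set T} -> bool) :=
  forall x y z, triangle E x y z ->
    psi [set x; y] = psi [set x; z] -> psi [set x; y] = psi [set y; z] -> False.

Definition extends B (phi : {set T} -> bool) A :=
  exists psi : {set T} -> bool, {in B, psi =1 phi} /\ mono_free (B :|: A) psi.


Lemma triangle_swap E x y z : triangle E x y z = triangle E y x z.
Proof. by rewrite /triangle (setUC [set x] [set y]); congr (_ && _); rewrite andbC. Qed.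

Lemma triangle_rot E x y z : triangle E x y z = triangle E y z x.
Proof.
by rewrite /triangle (setUC [set y] [set x]) !(setUC [set z]) andbA andbC.
Qed.

(** An extension to the other edges of A fails whichever colour ab receives, so each colour k is
    blocked by an apex joined to a and b in colour k. One [psi] serves both colours, which makes the
    two apices distinct. *)
Lemma critical_apex B phi A a b :
  is_graph (B :|: A) -> [disjoint A & B] -> ~ extends B phi A ->
  [set a; b] \in A -> extends B phi (A :\ [set a; b]) ->
  exists2 psi : {set T} -> bool, {in B, psi =1 phi} & forall k, exists u,
    [/\ [set a; u] \in B :|: A, [set b; u] \in B :|: A,
        psi [set a; u] = k & psi [set b; u] = k].
Proof.
move=> gr dAB nA eA [psi [psiB psiP]]; exists psi => // k.
pose psi' e := if e == [set a; b] then k else psi e.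
apply: contrapT => H; apply: nA; exists psi'; split.
  move=> e eB; rewrite /psi'; case: eqP => [ee|_]; last exact: psiB.
  by move/pred0P: dAB => /(_ e) /=; rewrite eB ee eA.
have notin e : e \in B :|: A -> e != [set a; b] -> e \in B :|: A :\ [set a; b].
  by rewrite !inE => /orP[->|->] // ->; rewrite orbT.
have key x y z : [set x; y] = [set a; b] -> triangle (B :|: A) x y z ->
    psi' [set x; y] = psi' [set x; z] -> psi' [set x; y] = psi' [set y; z] -> False.
  move=> exy /and3P[txy txz tyz].
  have [nxy nxz nyz] := And3 (graph_neq gr txy) (graph_neq gr txz) (graph_neq gr tyz).
  rewrite /psi' exy eqxx -exy !eq_set2 eqxx (eq_sym z) (negPf nyz) (negPf nxy) /=.
  rewrite (eq_sym y x) (negPf nxy) (eq_sym z) (negPf nxz) !andbF /= => e1 e2.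
  apply: H; exists z.
  by move/eqP: exy; rewrite eq_set2 => /orP[]/andP[/eqP<- /eqP<-].
move=> x y z; have [exy|nxy] := eqVneq [set x; y] [set a; b]; first exact: key.
have [exz|nxz] := eqVneq [set x; z] [set a; b].
  move=> t e1 e2; apply: (key x z y) => //.
  - by move: t; rewrite triangle_swap triangle_rot.
  - by rewrite (setUC [set z]) -e1 e2.
have [eyz|nyz] := eqVneq [set y; z] [set a; b].
  move=> t e1 e2; apply: (key y z x) => //.
  - by move: t; rewrite triangle_rot.
  - by rewrite (setUC [set y] [set x]).
  - by rewrite -e2 e1 (setUC [set z]).
rewrite /psi' (negPf nxy) (negPf nxz) (negPf nyz) => /and3P[txy txz tyz].
by apply: psiP; rewrite /triangle !notin.
Qed.

(** Otherwise no triangle uses both an edge of A inside U and an edge of A not inside U, and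
    extensions to these two parts of A, which exist by minimality, can be glued. *)
Lemma critical_grow B phi A U :
  ~ extends B phi A ->
  (forall D, D \proper A -> extends B phi D) ->
  induced A U != set0 -> induced A U != A ->
  exists a b c, [/\ a \in U, b \in U & c \notin U] /\
    [/\ [set a; b] \in A, [set a; c] \in A & [set b; c] \in B :|: A].
Proof.
move=> nA crit U0 UA.
have sUA : induced A U \subset A by apply/subsetP => e; rewrite inE => /andP[].
have [psi1 [psi1B psi1P]] : extends B phi (induced A U).
  by apply: crit; rewrite properEneq UA.
have [psi2 [psi2B psi2P]] : extends B phi (A :\: induced A U).
  by apply: crit; rewrite properEneq subsetDl andbT; apply/eqP => /setDidPl;
    rewrite disjoint_sym disjoints_subset => H;
    move: U0 => /set0Pn[e eU]; move/subsetP: H => /(_ e eU); rewrite inE (subsetP sUA).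
apply: contrapT => H; apply: nA.
pose psi e := if e \in induced A U then psi1 e else psi2 e.
exists psi; split.
  move=> e eB; rewrite /psi; case: ifP => _; [exact: psi1B|exact: psi2B].
have psiE e : psi e = if e \in induced A U then psi1 e else psi2 e by [].
have key x y z : triangle (B :|: A) x y z -> [set x; y] \in induced A U ->
    [set x; z] \notin A :\: induced A U /\ [set y; z] \notin A :\: induced A U.
  move=> /and3P[txy txz tyz]; rewrite mem_induced => /and3P[Axy xU yU].
  split; apply/negP; rewrite in_setD mem_induced ?xU ?yU andbC /= => /andP[Axz];
    rewrite Axz /= => zU; apply: H.
    by exists x, y, z.
  by exists y, x, z; rewrite (setUC [set y] [set x]).
have in1 e : e \in B :|: A -> e \notin A :\: induced A U ->
    e \in B :|: induced A U /\ psi e = psi1 e.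
  rewrite in_setU psiE in_setD in_setU => /orP[eB _|eA].
    by rewrite eB; split=> //; case: ifP => // _; rewrite psi1B // psi2B.
  by rewrite eA andbT negbK => ->; rewrite orbT.
have in2 e : e \in B :|: A -> e \notin induced A U ->
    e \in B :|: (A :\: induced A U) /\ psi e = psi2 e.
  by rewrite in_setU psiE !in_setU in_setD => eBA /[dup] /negPf-> ->.
move=> x y z t e1 e2.
have [/and3P[txy txz tyz]] := (t, t).
have t1 : triangle (B :|: A) x z y by move: t; rewrite triangle_swap triangle_rot.
have t2 : triangle (B :|: A) y z x by move: t; rewrite triangle_rot.
have [/or3P hin|] := boolP [|| [set x; y] \in induced A U,
   [set x; z] \in induced A U | [set y; z] \in induced A U].
  have [n1 n2 n3] : [/\ [set x; y] \notin A :\: induced A U,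
     [set x; z] \notin A :\: induced A U & [set y; z] \notin A :\: induced A U].
    case: hin => h.
    - by have [m1 m2] := key _ _ _ t h; split=> //; rewrite in_setD h.
    - have [m1 m2] := key _ _ _ t1 h.
      by split; [exact: m1|rewrite in_setD h|rewrite (setUC [set y])].
    - have [m1 m2] := key _ _ _ t2 h; split; last by rewrite in_setD h.
        by rewrite (setUC [set x]).
      by rewrite (setUC [set x]).
  have [[i1 p1] [i2 p2] [i3 p3]] := And3 (in1 _ txy n1) (in1 _ txz n2) (in1 _ tyz n3).
  by case: (psi1P x y z); rewrite /triangle ?i1 ?i2 -?p1 -?p2 -?p3.
rewrite !negb_or => /and3P[n1 n2 n3].
have [[i1 p1] [i2 p2] [i3 p3]] := And3 (in2 _ txy n1) (in2 _ txz n2) (in2 _ tyz n3).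
by case: (psi2P x y z); rewrite /triangle ?i1 ?i2 -?p1 -?p2 -?p3.
Qed.

Lemma card_edges_at E U u N : u \in U -> N \subset U ->
  (forall x, x \in N -> [set u; x] \in E) -> u \notin N ->
  #|N| <= #|[set e in induced E U | u \in e]|.
Proof.
move=> uU NU NE uN.
have inj : {in N &, injective (fun x => [set u; x])}.
  move=> x y xN yN /eqP; rewrite eq_set2 eqxx /= => /orP[/eqP //|/andP[/eqP e1 /eqP e2]].
  by rewrite e2 e1.
rewrite -(card_in_imset inj); apply/subset_leq_card/subsetP => e /imsetP[x xN ->].
by rewrite inE mem_induced NE // uU (subsetP NU) //= set21.
Qed.

(** Double counting of incidences: if all degrees were at least 4, then
    [4 * #|U| <= 2 * esize E U]. *)
Lemma exists_low_degree E U : is_graph E -> U != set0 ->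
  esize E U < 2 * #|U| ->
  exists2 u, u \in U & #|[set e in induced E U | u \in e]| <= 3.
Proof.
move=> gr U0 small; apply: contrapT => H.
have big u : u \in U -> 4 <= #|[set e in induced E U | u \in e]|.
  by move=> uU; rewrite ltnNge; apply/negP => h; apply: H; exists u.
have : \sum_(u in U) 4 <= \sum_(u in U) #|[set e in induced E U | u \in e]|.
  exact: leq_sum.
rewrite sum_nat_const.
have -> : \sum_(u in U) #|[set e in induced E U | u \in e]| = esize E U * 2.
  transitivity (\sum_(u in U) \sum_(e in induced E U | u \in e) 1).
    by apply: eq_bigr => u _; rewrite sum1dep_card; apply: eq_card => e; rewrite !inE.
  rewrite (exchange_big_dep (mem (induced E U))) /=; last by move=> u e _ /andP[].
  rewrite /esize -sum_nat_const; apply: eq_bigr => e eI.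
  have /[!inE] /andP[eE /subsetP eU] := eI.
  rewrite sum1dep_card -(gr e eE); apply: eq_card => u; rewrite !inE.
  by move: eI; rewrite !inE => -> /=; case: (boolP (u \in e)) => [/eU->|]; rewrite ?andbF.
by lia.
Qed.

(* A vertex whose two colours are both blocked has two disjoint pairs of
   neighbours, hence degree at least 4. *)
Lemma vertex_2colouring E U : is_graph E ->
  (forall W, W \subset U -> W != set0 -> esize E W < 2 * #|W|) ->
  exists f : T -> bool, forall x y z, x \in U -> y \in U -> z \in U ->
    triangle E x y z -> f x = f y -> f x = f z -> False.
Proof.
move=> gr; have [n] := ubnP #|U|; elim: n U => // n IH U leUn sparseU.
have [U0|U0] := eqVneq U set0; first by exists predT => x; rewrite U0 inE.
have [u uU du] := exists_low_degree gr U0 (sparseU U (subxx _) U0).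
have [f fP] : exists f : T -> bool, forall x y z, x \in U :\ u -> y \in U :\ u ->
    z \in U :\ u -> triangle E x y z -> f x = f y -> f x = f z -> False.
  apply: IH; first by have := cardsD1 u U; rewrite uU; lia.
  by move=> W WU; apply: sparseU; apply: subset_trans WU (subsetDl _ _).
apply: contrapT => H.
have key k : exists x y, [/\ x \in U, y \in U, x != y & f x = k] /\
    [/\ f y = k, [set u; x] \in E & [set u; y] \in E].
  apply: contrapT => Hk; apply: H; exists (fun w => if w == u then k else f w).
  have aux y z : y \in U -> z \in U -> triangle E u y z ->
      k = (if y == u then k else f y) -> k = (if z == u then k else f z) -> False.
    move=> yU zU /and3P[uy uz yz].
    have := graph_neq gr uy; have := graph_neq gr uz.
    rewrite !(eq_sym u) => /negPf-> /negPf-> e1 e2; apply: Hk.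
    by exists y, z; rewrite (graph_neq gr yz).
  move=> x y z xU yU zU t.
  have [xu|xu] := eqVneq x u; first by subst x; apply: aux.
  have [yu|yu] := eqVneq y u.
    subst y; rewrite ?eqxx ?(negPf xu) => e1 e2; apply: (aux x z) => //.
    - by rewrite triangle_swap.
    - by rewrite (negPf xu) e1.
    - by rewrite -e2 e1.
  have [zu|zu] := eqVneq z u.
    subst z; rewrite ?eqxx ?(negPf xu) ?(negPf yu) => e1 e2; apply: (aux x y) => //.
    - by rewrite triangle_rot.
    - by rewrite (negPf xu) e2.
    - by rewrite (negPf yu) -e1 e2.
  by apply: fP => //; rewrite !inE ?xu ?yu ?zu.
have [x [y [[xU yU xy fx] [fy ux uy]]]] := key true.
have [x' [y' [[x'U y'U x'y' fx'] [fy' ux' uy']]]] := key false.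
have neq p q : f p = true -> f q = false -> p != q.
  by move=> fp fq; apply/eqP => pq; move: fp; rewrite pq fq.
have : #|[set x; y] :|: [set x'; y']| = 4.
  rewrite cardsU !cards2 xy x'y' (_ : _ :&: _ = set0) ?cards0 //.
  apply/setP => w; rewrite !inE; apply/negP => /andP[/orP[]/eqP-> /orP[]/eqP e];
    by [move: (neq x x' fx fx'); rewrite e eqxx | move: (neq x y' fx fy'); rewrite e eqxx
      | move: (neq y x' fy fx'); rewrite e eqxx | move: (neq y y' fy fy'); rewrite e eqxx].
have : #|[set x; y] :|: [set x'; y']| <= #|[set e in induced E U | u \in e]|.
  apply: card_edges_at => //.
  - by rewrite !subUset !sub1set xU yU x'U.
  - by move=> w; rewrite !inE => /orP[/orP[]|/orP[]]/eqP->.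
  - rewrite !inE !negb_or.
    by rewrite (graph_neq gr ux) (graph_neq gr uy) (graph_neq gr ux') (graph_neq gr uy').
by move=> /leq_trans /(_ du) + e4; rewrite e4.
Qed.

Lemma dense_leq (v a b a' b' : nat) :
  a <= a' -> b <= b' -> too_dense v a b -> too_dense v a' b'.
Proof. by rewrite /too_dense => ? ? /and3P[? ? ?]; apply/and3P; split; lia. Qed.

Lemma sparse_dense E F U (a b : nat) : sparse E F -> #|U| <= 9 ->
  a <= esize E U -> b <= esize F U -> ~~ too_dense #|U| a b.
Proof. by move=> sp U9 ha hb; apply: contra (sp U U9); apply: dense_leq. Qed.

(* A critical edge set grows triangle by triangle: either up to a dense set of
   9 vertices, or it lives on at most 8 vertices, where a bipartition works. *)
Lemma sparse_colourable E F : is_graph E -> sparse E F ->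
  exists psi : {set T} -> bool, mono_free E psi.
Proof.
move=> gr sp.
suff: forall A, A \subset E -> extends set0 predT A.
  by move=> /(_ E (subxx _)) [psi [_]]; rewrite set0U; exists psi.
move=> A; have [n] := ubnP #|A|; elim: n A => // n IH A leAn AE.
apply: contrapT => nA.
have crit D : D \proper A -> extends set0 predT D.
  move=> DA; apply: IH; first by have := proper_card DA; lia.
  exact: subset_trans (proper_sub DA) AE.
have gA := is_graphS AE gr.
(* Equality holds for a triangle, and each further triangle brings one vertex and at least two
   edges; nine vertices would carry 15 edges. *)
pose P (U : {set T}) := [&& 3 <= #|U| <= 9 & 2 * #|U| <= esize A U + 3].
have [U0 PU0] : exists U, P U.
  apply: contrapT => H; apply: nA; exists predT; split=> // x y z.
  rewrite set0U => t _ _; apply: H; exists [set x; y; z].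
  have /and3P[xy xz yz] := t.
  have [nxy nxz nyz] := And3 (graph_neq gA xy) (graph_neq gA xz) (graph_neq gA yz).
  have c3 := cards3 nxy nxz nyz.
  have h : 1 <= esize A [set x; y].
    by rewrite /esize; apply/card_gt0P; exists [set x; y]; rewrite mem_induced xy set21 set22.
  have := @esize_add2 A [set x; y] z x y.
  rewrite !inE negb_or !(eq_sym z) nxz nyz !eqxx orbT nxy !(setUC [set z]) xz yz.
  move=> /(_ isT isT isT isT isT isT); by move: h; rewrite /P c3 /=; clear; lia.
have [U PU maxU] := arg_maxnP (fun U : {set T} => #|U|) PU0.
move: (PU) => /andP[/andP[U3 U9] hU].
have hAE : esize A U <= esize E U by apply/subset_leq_card/induced_subl.
have Ult : #|U| < 9.
  rewrite ltn_neqAle U9 andbT; apply/eqP => U9'.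
  have := sparse_dense sp U9 hAE (leq0n _); rewrite /too_dense U9' /=.
  by move: hU; rewrite U9'; clear; lia.
have UA : induced A U = A.
  apply: contrapT => /eqP UA.
  have U0' : induced A U != set0.
    by rewrite -card_gt0 -/(esize _ _); move: U3 hU; clear; lia.
  have [a [b [c [[aU bU cU] [ab ac bc]]]]] := critical_grow nA crit U0' UA.
  move: bc; rewrite set0U => bc.
  have := esize_add2 cU aU bU (graph_neq gA ab); rewrite !(setUC [set c] [set _]).
  move=> /(_ A ac bc) hc; have Pc : P (c |: U).
    by rewrite /P cardsU1 cU; move: U3 Ult hU hc; clear; lia.
  by have := maxU _ Pc; rewrite /= cardsU1 cU add1n ltnn.
have [f fP] : exists f : T -> bool, forall x y z, x \in U -> y \in U -> z \in U ->
    triangle A x y z -> f x = f y -> f x = f z -> False.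
  apply: vertex_2colouring => // W WU W0; rewrite ltnNge; apply/negP => h.
  have WU' := subset_leq_card WU.
  have hW : esize A W <= esize E W by apply/subset_leq_card/induced_subl.
  have := @sparse_dense E F W _ 0 sp _ hW (leq0n _).
  by rewrite /too_dense card_gt0 W0; move: h WU' Ult; clear; lia.
(* An edge is coloured by whether its ends differ under f. A triangle cannot have all three pairs of
   ends different, and [fP] excludes that all agree. *)
apply: nA; exists (fun e => [exists x in e, f x] && [exists x in e, ~~ f x]).
split=> [e|]; first by rewrite inE.
have ev x y : [exists w in [set x; y], f w] && [exists w in [set x; y], ~~ f w]
    = (f x (+) f y).
  have ex (g : pred T) : [exists w in [set x; y], g w] = g x || g y.
    apply/exists_inP/orP => [[w]|[]]; first by rewrite !inE => /orP[]/eqP->; [left|right].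
      by exists x; rewrite ?set21.
    by exists y; rewrite ?set22.
  by rewrite !ex; case: (f x); case: (f y).
move=> x y z; rewrite set0U !ev => t.
have /and3P[xy xz yz] := t.
move: (xy) (yz); rewrite -{1 2}UA !mem_induced => /and3P[_ xU yU] /and3P[_ _ zU].
have := fP x y z xU yU zU t.
by case: (f x); case: (f y); case: (f z) => //= /(_ erefl erefl).
Qed.

End Graphs.

(** * Extending a colouring of G1 to the edges of G2 *)

Section Extension.
Variable T : finType.
Implicit Types (U W N e : {set T}) (x y z u v w a b c d r t : T).

Lemma esize_sub (E : {set {set T}}) U W : U \subset W -> esize E U <= esize E W.
Proof.
move=> UW; apply/subset_leq_card/subsetP => e.
by rewrite !inE => /andP[-> /subset_trans->].
Qed.

Lemma triangle_edges (E : {set {set T}}) x y z : is_graph E -> triangle E x y z ->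
  3 <= esize E [set x; y; z].
Proof.
move=> gE /and3P[xy xz yz].
have [nxy nxz nyz] := And3 (graph_neq gE xy) (graph_neq gE xz) (graph_neq gE yz).
have <- : #|[set [set x; y]; [set x; z]; [set y; z]]| = 3.
  apply: cards3; rewrite eq_set2 !eqxx ?(negPf nyz) ?(eq_sym y x) ?(negPf nxy) //=;
    by rewrite ?(negPf nxz) ?(eq_sym z) ?(negPf nyz) ?andbF.
apply/subset_leq_card/subsetP => e; rewrite !inE => /orP[/orP[]|] /eqP->;
  by rewrite ?xy ?xz ?yz subUset !sub1set !inE !eqxx ?orbT.
Qed.

Section Critical.
Variables (E G A : {set {set T}}) (phi : {set T} -> bool).
Hypotheses (gE : is_graph E) (gG : is_graph G) (sp : sparse E G).
Hypothesis blueP : forall x y, [set x; y] \in E -> phi [set x; y] = false ->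
  exists r, [set x; r] \in E /\ [set y; r] \in E.
Hypothesis noclash : forall x y z w, [set x; y] \in G -> [set x; y] \notin E ->
  [set x; z] \in E -> [set y; z] \in E -> [set x; w] \in E -> [set y; w] \in E ->
  phi [set x; z] = false -> phi [set y; z] = false ->
  phi [set x; w] = true -> phi [set y; w] = true -> False.
Hypotheses (AG : A \subset G :\: E) (nA : ~ extends E phi A).
Hypothesis crit : forall D : {set {set T}}, D \proper A -> extends E phi D.

Let C := E :|: A.
Let h U := esize C U.
Let f U := esize A U.

Let AnE e : e \in A -> e \notin E.
Proof. by move=> /(subsetP AG); rewrite inE => /andP[]. Qed.

Let AinG e : e \in A -> e \in G.
Proof. by move=> /(subsetP AG); rewrite inE => /andP[]. Qed.

Let AC e : e \in A -> e \in C.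
Proof. by rewrite inE orbC => ->. Qed.

Let gC : is_graph C.
Proof. by move=> e /setUP[/gE|/AinG/gG]. Qed.

(** Since A is disjoint from E, a set with a edges of E and b = [f U] edges of A has [h U] = a + b,
    and 6a + 9b = 6 [h U] + 3 [f U]. *)
Let no_dense U : 0 < #|U| <= 9 -> 3 * #|U| <= 2 * h U ->
  10 * #|U| <= 6 * h U + 3 * f U -> False.
Proof.
move=> /andP[U0 U9] h1 h2.
have hf : h U <= esize E U + f U.
  rewrite /h /f /esize; have -> : induced C U = induced E U :|: induced A U.
    by apply/setP => e; rewrite !inE andb_orl.
  by rewrite cardsU leq_subr.
have fG : f U <= esize G U.
  by apply/subset_leq_card/induced_subl/subsetP => e; apply: AinG.
move/negP: (sparse_dense sp U9 (leqnn _) fG); apply.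
by rewrite /too_dense U0; move: hf h1 h2; clear; lia.
Qed.

Let f_add U u : f U <= f (u |: U).
Proof. exact/esize_sub/subsetUr. Qed.

(** Here u blocks red and v blocks blue. Colours are recorded only for edges of E: those of A have
    theirs from a particular extension, which is forgotten. *)
Let apex a b : [set a; b] \in A -> exists u v, [/\ u != v,
  [set a; u] \in C /\ [set b; u] \in C, [set a; v] \in C /\ [set b; v] \in C,
  ([set a; u] \in E -> phi [set a; u]) /\ ([set b; u] \in E -> phi [set b; u]) &
  ([set a; v] \in E -> phi [set a; v] = false) /\
  ([set b; v] \in E -> phi [set b; v] = false)].
Proof.
move=> abA.
have dis : [disjoint A & E].
  by apply/pred0P => e /=; apply/negP => /andP[/AnE/negPf->].
have [psi psiE H] := critical_apex gC dis nA abA (crit (properD1 abA)).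
have [u [u1 u2 u3 u4]] := H true; have [v [v1 v2 v3 v4]] := H false.
exists u, v; split=> //.
- by apply/eqP => uv; move: u3; rewrite uv v3.
- by split=> i; rewrite -psiE // ?u3 ?u4.
- by split=> i; rewrite -psiE // ?v3 ?v4.
Qed.

Let edge_neqC a b : [set a; b] \in C -> a != b.
Proof. exact: graph_neq gC. Qed.

Let AE2 e : e \in A -> exists a b, a != b /\ e = [set a; b].
Proof. by move=> eA; apply/cards2P; rewrite (gC (AC eA)). Qed.

Let AE1 e c : e \in A -> c \in e -> exists d, e = [set c; d].
Proof.
move=> eA; have [x [y [_ ->]]] := AE2 eA.
rewrite !inE => /orP[]/eqP->; first by exists y.
by exists x; rewrite setUC.
Qed.

Let add2 W a b u : u \notin W -> a \in W -> b \in W -> a != b ->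
  [set a; u] \in C -> [set b; u] \in C -> h W + 2 <= h (u |: W).
Proof.
by move=> uW aW bW ab au bu; apply: (esize_add2 (x := a) (y := b)); rewrite // setUC.
Qed.

Let add3 W a b c u : u \notin W -> a \in W -> b \in W -> c \in W ->
  a != b -> a != c -> b != c ->
  [set a; u] \in C -> [set b; u] \in C -> [set c; u] \in C -> h W + 3 <= h (u |: W).
Proof.
move=> uW aW bW cW ab ac bc au bu cu.
by apply: (esize_add3 (x := a) (y := b) (z := c)); rewrite // setUC.
Qed.

(** An apex outside U would give 6 vertices with 9 edges, 4 of them in A: 18 <= 18 and 60 <= 54 +
    12. *)
Let one_apex U a b u : #|U| = 5 -> 7 <= h U -> 4 <= f U ->
  a \in U -> b \in U -> [set a; b] \in C ->
  [set a; u] \in C -> [set b; u] \in C -> u \in U.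
Proof.
move=> U5 h7 f4 aU bU ab au bu; apply: contrapT => /negP uU.
have h' := add2 uU aU bU (edge_neqC ab) au bu; have f' := f_add U u.
by apply: (@no_dense (u |: U)); rewrite cardsU1 uU U5; move: h7 f4 h' f'; clear; lia.
Qed.

Variable U : {set T}.
Hypotheses (UA : induced A U = A) (Ucov : U \subset cover A).
Hypotheses (hU : 2 * #|U| <= h U + 3) (fU : #|U| <= f U + 1).

Let AU a b : [set a; b] \in A -> a \in U /\ b \in U.
Proof. by rewrite -UA mem_induced => /and3P[]. Qed.

Let outE a u : u \notin U -> [set a; u] \in C -> [set a; u] \in E.
Proof. by move=> uU /setUP[//|/AU[_]]; rewrite (negPf uU). Qed.

Let fUA : f U = #|A|.
Proof. by rewrite /f /esize UA. Qed.

(** Both apices of the only edge of A lie outside U, so they are reached by edges of E coloured by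
    [phi], as [noclash] forbids. *)
Let critical2 : #|U| = 2 -> False.
Proof.
move=> U2; have /card_gt0P[e eA] : 0 < #|A|.
  by rewrite -fUA; move: fU; rewrite U2; clear; lia.
have [a [b [ab ee]]] := AE2 eA; subst e; have [aU bU] := AU eA.
have Uab : U = [set a; b].
  by apply/esym/eqP; rewrite eqEcard subUset !sub1set aU bU cards2 ab U2.
have [u [v [uv [au bu] [av bv] [pau pbu] [pav pbv]]]] := apex eA.
have out w : [set a; w] \in C -> [set b; w] \in C -> w \notin U.
  by move=> /edge_neqC aw /edge_neqC bw; rewrite Uab !inE negb_or !(eq_sym w) aw.
have [uU vU] := (out u au bu, out v av bv).
apply: (noclash (AinG eA) (AnE eA) (z := v) (w := u)); first [exact: outE |
  by apply: pav; apply: outE | by apply: pbv; apply: outE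
     | by apply: pau; apply: outE | by apply: pbu; apply: outE].
Qed.

Let outer e := exists2 r, r \notin U & forall x, x \in e -> [set r; x] \in C.

Let outerP a b : [set a; b] \in A -> outer [set a; b] \/
  exists u v, [/\ u != v, u \in U, v \in U & [/\ [set a; u] \in C, [set b; u] \in C,
    [set a; v] \in C & [set b; v] \in C]].
Proof.
move=> abA; have [u [v [uv [au bu] [av bv] _ _]]] := apex abA.
have out w : [set a; w] \in C -> [set b; w] \in C -> w \notin U -> outer [set a; b].
  move=> aw bw wU; exists w => // x /set2P[]->; by rewrite setUC.
have [uU|uU] := boolP (u \in U); last by left; apply: out au bu uU.
have [vU|vU] := boolP (v \in U); last by left; apply: out av bv vU.
by right; exists u, v.
Qed.

(** Both apices r, r' of vd lie in U, so v has the three neighbours d, r, r' in W. *)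
Let inner_degree W v d : v \notin W -> U = v |: W -> [set v; d] \in A ->
  ~ outer [set v; d] -> h W + 3 <= h U.
Proof.
move=> vW UW vdA; have [//|] := outerP vdA.
move=> [r [r' [rr' rU r'U [vr dr vr' dr']]]] _.
have inW w : [set v; w] \in C -> w \in U -> w \in W.
  by rewrite UW in_setU1 => /edge_neqC; rewrite eq_sym => /negPf->.
have := add3 vW (inW _ (AC vdA) (AU vdA).2) (inW _ vr rU) (inW _ vr' r'U)
  (edge_neqC dr) (edge_neqC dr') rr'.
rewrite !(setUC [set _] [set v]) => /(_ (AC vdA) vr vr').
by rewrite UW.
Qed.

(** No apex leaves U. An edge of A and its two apices form 4 vertices with 5 edges, and the fifth
    vertex, being covered by A, brings 3 more; 8 edges on 5 vertices are too dense. *)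
Let critical5 : #|U| = 5 -> False.
Proof.
move=> U5.
have [h7 f4] : 7 <= h U /\ 4 <= f U by split; move: hU fU; rewrite U5; clear; lia.
have no_outer a b : [set a; b] \in A -> ~ outer [set a; b].
  move=> ab [r rU rP]; have [aU bU] := AU ab; move/negP: (rU); apply.
  by apply: (one_apex U5 h7 f4 aU bU (AC ab)); rewrite setUC rP // ?set21 ?set22.
have /card_gt0P[e eA] : 0 < #|A| by rewrite -fUA; exact: leq_trans f4.
have [a [b [ab ee]]] := AE2 eA; subst e; have [aU bU] := AU eA.
have [//|[u [v [uv uU vU [au bu av bv]]]]] := outerP eA; first by move/no_outer: eA.
pose W := v |: [set a; b; u].
have vW : v \notin [set a; b; u].
  by rewrite !inE !negb_or !(eq_sym v) (edge_neqC av) (edge_neqC bv).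
have W4 : #|W| = 4 by rewrite cardsU1 vW cards3 // edge_neqC.
have hW : 5 <= h W.
  have t : triangle C a b u by rewrite /triangle AC // au bu.
  have aW : a \in [set a; b; u] by rewrite !inE eqxx.
  have bW : b \in [set a; b; u] by rewrite !inE eqxx orbT.
  have := add2 vW aW bW ab av bv; have := triangle_edges gC t; rewrite -/(h _).
  by rewrite -/W; clear; lia.
have WU : W \subset U by rewrite !subUset !sub1set aU bU uU vU.
have [c cU cW] : exists2 c, c \in U & c \notin W.
  by apply/subsetPn; apply/negP => /subset_leq_card; rewrite W4 U5.
have UW : U = c |: W.
  by apply/esym/eqP; rewrite eqEcard subUset sub1set cU WU cardsU1 cW W4 U5.
have /bigcupP[e eA' ce] := subsetP Ucov _ cU.
have [d ed] := AE1 eA' ce.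
subst e; have h8 := inner_degree cW UW eA' (no_outer _ _ eA').
by apply: (@no_dense U); rewrite U5; move: hW h8 f4; clear; lia.
Qed.

(** Six edges on U would be too dense, so there are only five; hence of any two edges of A at least
    one has an outer apex. Among three edges of A two have outer apices, and adding these is too
    dense whether or not they coincide. *)
Let critical4 : #|U| = 4 -> False.
Proof.
move=> U4.
have [h5 f3] : 5 <= h U /\ 3 <= f U by split; move: hU fU; rewrite U4; clear; lia.
have h6 : h U < 6.
  by rewrite ltnNge; apply/negP => h6; apply: (@no_dense U); rewrite U4 //;
    move: h6 f3; clear; lia.
have inner a b u v d : [set a; b] \in A -> u != v -> u \in U -> v \in U ->
    [set a; u] \in C -> [set b; u] \in C -> [set a; v] \in C -> [set b; v] \in C ->
    [set v; d] \in A -> outer [set v; d].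
  move=> eA uv uU vU au bu av bv vdA; apply: contrapT => nout.
  have [aU bU] := AU eA; have ab := edge_neqC (AC eA).
  have t : triangle C a b u by rewrite /triangle AC // au bu.
  have vW : v \notin [set a; b; u].
    by rewrite !inE !negb_or !(eq_sym v) (edge_neqC av) (edge_neqC bv).
  have UW : U = v |: [set a; b; u].
    apply/esym/eqP; rewrite eqEcard !subUset !sub1set aU bU uU vU cardsU1 vW.
    by rewrite cards3 ?U4 // edge_neqC.
  have := inner_degree vW UW vdA nout; have := triangle_edges gC t.
  by rewrite -/(h _); move: h6; clear; lia.
have two e e' : e \in A -> e' \in A -> e != e' -> outer e \/ outer e'.
  move=> eA e'A neq.
  have [a [b [ab ee]]] := AE2 eA; subst e.
  have [|[u [v [uv uU vU [au bu av bv]]]]] := outerP eA; first by left.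
  right; have [aU bU] := AU eA.
  have vW : v \notin [set a; b; u].
    by rewrite !inE !negb_or !(eq_sym v) (edge_neqC av) (edge_neqC bv).
  have UW : U = v |: [set a; b; u].
    apply/esym/eqP; rewrite eqEcard !subUset !sub1set aU bU uU vU cardsU1 vW.
    by rewrite cards3 ?U4 // edge_neqC.
  have [w we' wuv] : exists2 w, w \in e' & w \in [set u; v].
    apply: contrapT => H; case/negP: neq; rewrite eq_sym eqEcard cards2 ab.
    rewrite (gC (AC e'A)) andbT; apply/subsetP => w we'.
    have : w \in U by move: e'A; rewrite -UA inE => /andP[_ /subsetP]; apply.
    rewrite UW !inE => wU; have : w \notin [set u; v] by apply/negP => ?; apply: H; exists w.
    by rewrite !inE; move: wU; do 4 case: (w == _).
  have [d ed] := AE1 e'A we'; subst e'.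
  move: wuv; rewrite !inE => /orP[]/eqP ww; subst w.
    by apply: (inner a b v u); rewrite // eq_sym.
  exact: (inner a b u v).
have fin e e' : e \in A -> e' \in A -> e != e' -> outer e -> outer e' -> False.
  move=> eA e'A neq [r rU re] [r' r'U re'].
  have eU : e \subset U by move: eA; rewrite -UA inE => /andP[].
  have eU' : e' \subset U by move: e'A; rewrite -UA inE => /andP[].
  have [e2 e2'] := (gC (AC eA), gC (AC e'A)).
  have fr := f_add U r.
  have [rr|rr] := eqVneq r r'.
    subst r'.
    have e3 : 3 <= #|e :|: e'|.
      rewrite ltnNge; apply/negP => le2; case/negP: neq.
      have /eqP-> : e == e :|: e' by rewrite eqEcard subsetUl e2.
      by rewrite eq_sym eqEcard subsetUr e2'.
    have hr : h U + #|e :|: e'| <= h (r |: U).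
      apply: esize_add => //; first by rewrite subUset eU.
      by move=> x /setUP[/re|/re'].
    by apply: (@no_dense (r |: U)); rewrite cardsU1 rU U4; move: h5 f3 fr hr e3; clear; lia.
  have [a [b [ab ee]]] := AE2 eA; have [a' [b' [ab' ee']]] := AE2 e'A.
  have [[aU bU] [aU' bU']] : (a \in U /\ b \in U) /\ (a' \in U /\ b' \in U).
    by split; apply: AU; rewrite -?ee -?ee'.
  have hr : h U + 2 <= h (r |: U).
    by apply: (add2 (a := a) (b := b)); rewrite // setUC re // ee ?set21 ?set22.
  have r'U1 : r' \notin r |: U by rewrite !inE negb_or eq_sym rr.
  have hr' : h (r |: U) + 2 <= h (r' |: (r |: U)).
    by apply: (add2 r'U1 (setU1r _ aU') (setU1r _ bU') ab');
      rewrite setUC re' // ee' ?set21 ?set22.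
  have fr' := f_add (r |: U) r'.
  apply: (@no_dense (r' |: (r |: U))); rewrite !cardsU1 r'U1 rU U4;
    move: h5 f3 fr fr' hr hr'; clear; lia.
have /card_gt2P[e1 [e2 [e3 [[e1A e2A e3A] [n12 n23 n31]]]]] : 2 < #|A| by rewrite -fUA.
have [o1|o2] := two e1 e2 e1A e2A n12.
  have [o2|o3] := two e2 e3 e2A e3A n23; first exact: (fin e1 e2).
  by apply: (fin e1 e3); rewrite // eq_sym.
have [o3|o1] := two e3 e1 e3A e1A n31; first exact: (fin e2 e3).
exact: (fin e1 e2).
Qed.

(** The three apices are distinct, as a common one would complete a K4. Then 6 vertices carry 9
    edges, at least 2 of them in A, and both density conditions can be equalities: this is the
    critical pattern n^6 p^7 q^2. *)
Let three_outer x y z r1 r2 r3 : U = [set x; y; z] -> x != y -> x != z -> y != z ->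
  [set x; y] \in C -> [set x; z] \in C -> [set y; z] \in C -> 2 <= f U ->
  r1 \notin U -> r2 \notin U -> r3 \notin U ->
  [set x; r1] \in C -> [set z; r1] \in C -> [set y; r2] \in C -> [set z; r2] \in C ->
  [set x; r3] \in C -> [set y; r3] \in C -> False.
Proof.
move=> UE xy xz yz Cxy Cxz Cyz f2 r1U r2U r3U x1 z1 y2 z2 x3 y3.
have [xU yU zU] : [/\ x \in U, y \in U & z \in U] by rewrite UE !inE !eqxx !orbT.
have U3 : #|U| = 3 by rewrite UE cards3.
have h3 : 3 <= h U by rewrite UE; apply: triangle_edges => //; rewrite /triangle Cxy Cxz.
have common r : r \notin U -> [set x; r] \in C -> [set y; r] \in C ->
    [set z; r] \in C -> False.
  move=> rU xr yr zr; have hr := add3 rU xU yU zU xy xz yz xr yr zr.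
  have fr := f_add U r.
  by apply: (@no_dense (r |: U)); rewrite cardsU1 rU U3; move: h3 f2 fr hr; clear; lia.
have n12 : r2 != r1 by apply/eqP => e; subst r2; exact: (common r1).
have n13 : r3 != r1 by apply/eqP => e; subst r3; exact: (common r1).
have n23 : r3 != r2 by apply/eqP => e; subst r3; exact: (common r2).
have h1 := add2 r1U xU zU xz x1 z1; have f1 := f_add U r1.
have r2U1 : r2 \notin r1 |: U by rewrite !inE negb_or n12.
have h2 : h (r1 |: U) + 2 <= h (r2 |: (r1 |: U)).
  exact: (add2 r2U1 (setU1r _ yU) (setU1r _ zU)).
have f2' := f_add (r1 |: U) r2.
have r3U1 : r3 \notin r2 |: (r1 |: U) by rewrite !inE !negb_or n13 n23.
have h3' : h (r2 |: (r1 |: U)) + 2 <= h (r3 |: (r2 |: (r1 |: U))).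
  exact: (add2 r3U1 (setU1r _ (setU1r _ xU)) (setU1r _ (setU1r _ yU))).
have f3' := f_add (r2 |: (r1 |: U)) r3.
by apply: (@no_dense (r3 |: (r2 |: (r1 |: U)))); rewrite !cardsU1 r3U1 r2U1 r1U U3;
  move: h3 f2 h1 f1 h2 f2' h3' f3'; clear; lia.
Qed.

(** The colour of xy decides. If xy is in A, or is a blue edge of E, it has an outer apex by
    minimality or by [blueP], and [three_outer] applies. If it is red, the blue apices v1 of xz and
    v2 of yz cannot lie in U, and the triangle on the blue edge z v1 supplies the missing edges. *)
Let critical3_edges x y z : U = [set x; y; z] -> x != y -> x != z -> y != z ->
  [set x; z] \in A -> [set y; z] \in A -> False.
Proof.
move=> UE xy xz yz xzA yzA.
have [xU yU zU] : [/\ x \in U, y \in U & z \in U] by rewrite UE !inE !eqxx !orbT.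
have U3 : #|U| = 3 by rewrite UE cards3.
have [h3 f2] : 3 <= h U /\ 2 <= f U by split; move: hU fU; rewrite U3; clear; lia.
have Cxy : [set x; y] \in C.
  apply: contrapT => /negP xyC.
  have : h U <= #|[set [set x; z]; [set y; z]]|.
    apply/subset_leq_card/subsetP => e; rewrite inE => /andP[eC eU].
    have [a [b [ab ee]]] : exists a b, a != b /\ e = [set a; b].
      by apply/cards2P; rewrite (gC eC).
    have mem w : w \in U -> [\/ w = x, w = y | w = z].
      by rewrite UE !inE -orbA => /or3P[]/eqP->; [constructor 1|constructor 2|constructor 3].
    subst e; move: eU; rewrite subUset !sub1set => /andP[/mem aU /mem bU].
    move: eC ab; case: aU => ->; case: bU => ->; rewrite ?eqxx // => eC _.
    + by rewrite eC in xyC.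
    + by rewrite set21.
    + by rewrite setUC eC in xyC.
    + by rewrite set22.
    + by rewrite (setUC [set z]) set21.
    + by rewrite (setUC [set z]) set22.
  by rewrite cards2 => h2; have := leq_trans h3 h2; case: (_ != _).
have out a b u : [set a; b] \in A -> [set a; u] \in C -> [set b; u] \in C ->
    u != x -> u != y -> u != z -> u \notin U.
  by move=> *; rewrite UE !inE !negb_or; do !(apply/andP; split).
have outer_in a b c : [set a; b] \in A -> U = [set a; b; c] -> exists r,
    [/\ r \notin U, [set a; r] \in C & [set b; r] \in C].
  move=> abA UE'; have [|] := outerP abA.
    by move=> [r rU rP]; exists r; rewrite (setUC [set a]) (setUC [set b]) !rP ?set21 ?set22.
  move=> [u [v [uv uU vU [au bu av bv]]]]; case/negP: uv.
  move: uU vU; rewrite UE' !inE !(eq_sym _ a) !(eq_sym _ b).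
  rewrite (negPf (edge_neqC au)) (negPf (edge_neqC bu)) (negPf (edge_neqC av)).
  by rewrite (negPf (edge_neqC bv)) /= => /eqP-> /eqP->.
have UE1 : U = [set x; z; y].
  by rewrite UE; apply/setP => w; rewrite !inE; do 3 case: (w == _).
have UE2 : U = [set y; z; x].
  by rewrite UE; apply/setP => w; rewrite !inE; do 3 case: (w == _).
have [r1 [r1U xr1 zr1]] := outer_in _ _ _ xzA UE1.
have [r2 [r2U yr2 zr2]] := outer_in _ _ _ yzA UE2.
have fin r3 : r3 \notin U -> [set x; r3] \in C -> [set y; r3] \in C -> False.
  move=> *; apply: (three_outer (x := x) (y := y) (z := z) (r1 := r1) (r2 := r2) (r3 := r3));
    by rewrite // AC.
have [xyA|xyA] := boolP ([set x; y] \in A).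
  by have [r3 [r3U xr3 yr3]] := outer_in _ _ _ xyA UE; apply: (fin r3).
have xyE : [set x; y] \in E by move: Cxy; rewrite inE (negPf xyA) orbF.
have notU a b t : [set a; b] \in A -> [set a; t] \in C -> [set b; t] \in C ->
    t \notin U \/ U = [set a; b; t].
  move=> abA aT bT; have [aU bU] := AU abA.
  have [tU|] := boolP (t \in U); last by left.
  right; apply/esym/eqP; rewrite eqEcard !subUset !sub1set aU bU tU.
  by rewrite cards3 ?U3 // ?edge_neqC // AC.
have xzE := AnE xzA; have yzE := AnE yzA.
case pxy: (phi [set x; y]); last first.
  have [t [xt yt]] := blueP xyE pxy.
  have tU : t \notin U.
    rewrite UE !inE !negb_or !(eq_sym t) (graph_neq gE xt) (graph_neq gE yt) /=.
    by apply/eqP => zt; move: xzE; rewrite zt xt.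
  by apply: (fin t); rewrite // inE ?xt ?yt.
have bluez a b c : [set a; b] \in A -> U = [set a; b; c] -> [set a; c] = [set x; y] \/
    [set b; c] = [set x; y] -> a != b -> a != c -> b != c ->
    exists v, [/\ v \notin U, [set a; v] \in E,
    [set b; v] \in E, phi [set a; v] = false & phi [set b; v] = false].
  move=> abA UE' acxy ab ac bc.
  have [_ [v [_ _ [av bv] _ [pa pb]]]] := apex abA.
  have vU : v \notin U.
    rewrite UE' !inE !negb_or !(eq_sym v) (edge_neqC av) (edge_neqC bv) /=.
    apply/eqP => vc; subst v.
    by case: acxy => e; [move: pa|move: pb]; rewrite e => /(_ xyE); rewrite pxy.
  have [av' bv'] := (outE vU av, outE vU bv).
  by exists v; rewrite av' bv' pa ?pb.
have [v1 [v1U xv1 zv1 _ pz1]] : exists v, [/\ v \notin U, [set x; v] \in E,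
    [set z; v] \in E, phi [set x; v] = false & phi [set z; v] = false].
  by apply: (bluez x z y); rewrite // 1?eq_sym //; left.
have [v2 [v2U yv2 zv2 _ _]] : exists v, [/\ v \notin U, [set y; v] \in E,
    [set z; v] \in E, phi [set y; v] = false & phi [set z; v] = false].
  by apply: (bluez y z x); rewrite // 1?eq_sym //; left; rewrite setUC.
have EC e : e \in E -> e \in C by move=> eE; rewrite inE eE.
have [t [zt v1t]] := blueP zv1 pz1.
have n12 : v2 != v1.
  apply/eqP => e; subst v2.
  have hr := add3 v1U xU yU zU xy xz yz (EC _ xv1) (EC _ yv2) (EC _ zv1).
  have fr := f_add U v1.
  by apply: (@no_dense (v1 |: U)); rewrite cardsU1 v1U U3; move: h3 f2 fr hr; clear; lia.
have h1 := add2 v1U xU zU xz (EC _ xv1) (EC _ zv1); have f1 := f_add U v1.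
have v2U1 : v2 \notin v1 |: U by rewrite !inE negb_or n12.
have yU1 : y \in v1 |: U by rewrite !inE yU orbT.
have zU1 : z \in v1 |: U by rewrite !inE zU orbT.
have v1U1 : v1 \in v1 |: U by rewrite !inE eqxx.
have f2' := f_add (v1 |: U) v2.
have [tv2|tv2] := eqVneq t v2.
  subst t; have yv1 : y != v1 by apply/eqP => e; move: v1U; rewrite -e yU.
  have := add3 v2U1 yU1 zU1 v1U1 yz yv1 (graph_neq gE zv1) (EC _ yv2) (EC _ zv2) (EC _ v1t).
  move=> h2; apply: (@no_dense (v2 |: (v1 |: U))); rewrite !cardsU1 v2U1 v1U U3;
    move: h3 f2 h1 f1 h2 f2'; clear; lia.
have h2 := add2 v2U1 yU1 zU1 yz (EC _ yv2) (EC _ zv2).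
(* The vertex z is joined in E neither to x nor to y, because xz and yz lie in A. *)
have tU : t \notin U.
  rewrite UE !inE !negb_or !(eq_sym t) (graph_neq gE zt) andbT.
  by apply/andP; split; apply/eqP => e; subst t;
    [move: xzE | move: yzE]; rewrite setUC zt.
have tU1 : t \notin v2 |: (v1 |: U).
  by rewrite !inE !negb_or tv2 eq_sym (graph_neq gE v1t).
have h4 : h (v2 |: (v1 |: U)) + 2 <= h (t |: (v2 |: (v1 |: U))).
  exact: (add2 tU1 (setU1r _ zU1) (setU1r _ v1U1) (graph_neq gE zv1) (EC _ zt) (EC _ v1t)).
have f4 := f_add (v2 |: (v1 |: U)) t.
by apply: (@no_dense (t |: (v2 |: (v1 |: U)))); rewrite !cardsU1 tU1 v2U1 v1U U3;
  move: h3 f2 h1 f1 h2 f2' h4 f4; clear; lia.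
Qed.

Let critical3 : #|U| = 3 -> False.
Proof.
move=> U3.
have f2 : 1 < #|A| by rewrite -fUA; move: hU fU; rewrite U3; clear; lia.
have /card_gt1P[e [e' [eA e'A ee']]] := f2.
have [a [b [ab ee]]] := AE2 eA; subst e; have [aU bU] := AU eA.
have [c ce' cab] : exists2 c, c \in e' & c \notin [set a; b].
  apply/subsetPn; apply/negP => sub; case/negP: ee'.
  by rewrite eq_sym eqEcard sub cards2 ab (gC (AC e'A)).
have [d ed] := AE1 e'A ce'; subst e'; have [cU dU] := AU e'A.
have /[!inE] /[!negb_or] /andP[ca cb] := cab.
have UE : U = [set a; b; c].
  by apply/esym/eqP; rewrite eqEcard !subUset !sub1set aU bU cU cards3 ?U3 // eq_sym.
have cd := edge_neqC (AC e'A).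
move: dU; rewrite UE !inE -orbA => /or3P[]/eqP dd; subst d.
- apply: (critical3_edges (x := b) (y := c) (z := a)); rewrite // 1?eq_sym //.
    by rewrite UE; apply/setP => w; rewrite !inE; do 3 case: (w == _).
  by rewrite setUC.
- apply: (critical3_edges (x := a) (y := c) (z := b)); rewrite // 1?eq_sym //.
  by rewrite UE; apply/setP => w; rewrite !inE; do 3 case: (w == _).
- by rewrite eqxx in cd.
Qed.

Lemma critical_cover_false : 2 <= #|U| <= 5 -> False.
Proof.
have := critical2; have := critical3; have := critical4; have := critical5; clear; lia.
Qed.

End Critical.

(* The edge set of a minimal non-extendable A grows triangle by triangle from
   a single edge; six vertices would be too dense. *)
Lemma sparse_extends (E G : {set {set T}}) (phi : {set T} -> bool) :
  is_graph E -> is_graph G -> sparse E G -> mono_free E phi ->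
  (forall x y, [set x; y] \in E -> phi [set x; y] = false ->
     exists r, [set x; r] \in E /\ [set y; r] \in E) ->
  (forall x y z w, [set x; y] \in G -> [set x; y] \notin E ->
     [set x; z] \in E -> [set y; z] \in E -> [set x; w] \in E -> [set y; w] \in E ->
     phi [set x; z] = false -> phi [set y; z] = false ->
     phi [set x; w] = true -> phi [set y; w] = true -> False) ->
  extends E phi (G :\: E).
Proof.
move=> gE gG sp phiP blueP noclash.
suff: forall A : {set {set T}}, A \subset G :\: E -> extends E phi A by apply.
move=> A; have [n] := ubnP #|A|; elim: n A => // n IH A leAn AG.
apply: contrapT => nA.
have crit (D : {set {set T}}) : D \proper A -> extends E phi D.
  move=> DA; apply: IH; last exact: subset_trans (proper_sub DA) AG.
  by have := proper_card DA; move: leAn; clear; lia.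
have gA : is_graph A.
  by move=> e /(subsetP AG); rewrite inE => /andP[_ /gG].
have gEA : is_graph (E :|: A) by move=> e /setUP[/gE|/gA].
(* Both inequalities are equalities for a single edge. Each added vertex brings two edges of
   [E :|: A], at least one of them in A, so six vertices would carry 9 edges, 5 of them in A. *)
pose P U := [&& 2 <= #|U| <= 6, U \subset cover A,
  2 * #|U| <= esize (E :|: A) U + 3 & #|U| <= esize A U + 1].
have [U0 PU0] : exists U, P U.
  have [A0|/set0Pn[e eA]] := eqVneq A set0.
    by case: nA; exists phi; split=> //; rewrite A0 setU0.
  exists e; rewrite /P (gA e eA) /= (bigcup_sup e) //=.
  have one (D : {set {set T}}) : e \in D -> 1 <= esize D e.
    by move=> eD; apply/card_gt0P; exists e; rewrite inE eD subxx.
  have := one A eA; have := one (E :|: A); rewrite inE eA orbT => /(_ isT); clear; lia.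
have [U PU maxU] := arg_maxnP (fun U : {set T} => #|U|) PU0.
move: (PU) => /and4P[/andP[U2 U6] Ucov hU fU].
have fG W : esize A W <= esize G W.
  by apply/subset_leq_card/induced_subl/subsetP => e /(subsetP AG); rewrite inE => /andP[].
have hf W : esize (E :|: A) W <= esize E W + esize A W.
  rewrite /esize; have -> : induced (E :|: A) W = induced E W :|: induced A W.
    by apply/setP => e; rewrite !inE andb_orl.
  by rewrite cardsU leq_subr.
have Ult : #|U| < 6.
  rewrite ltn_neqAle U6 andbT; apply/eqP => e6.
  have U9 : #|U| <= 9 by rewrite e6.
  move/negP: (sparse_dense sp U9 (leqnn _) (fG U)); apply.
  by rewrite /too_dense; move: (hf U) hU fU; rewrite e6; clear; lia.
have UA : induced A U = A.
  apply: contrapT => /eqP UA.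
  have U0' : induced A U != set0.
    by rewrite -card_gt0 -/(esize _ _); move: U2 fU; clear; lia.
  have [a [b [c [[aU bU cU] [ab ac bc]]]]] := critical_grow nA crit U0' UA.
  have acE : [set a; c] \in E :|: A by rewrite inE ac orbT.
  have hc : esize (E :|: A) U + 2 <= esize (E :|: A) (c |: U).
    by apply: (esize_add2 cU aU bU (graph_neq gA ab)); rewrite setUC.
  have fc : esize A U + 1 <= esize A (c |: U).
    by apply: (esize_add1 cU aU); rewrite setUC.
  have Pc : P (c |: U).
    rewrite /P cardsU1 cU subUset Ucov sub1set andbT.
    have -> : c \in cover A by apply/bigcupP; exists [set a; c]; rewrite ?set22.
    by move: U2 Ult hU fU hc fc; clear; lia.
  by have := maxU _ Pc; rewrite /= cardsU1 cU add1n ltnn.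
apply: (critical_cover_false gE gG sp blueP noclash AG nA crit UA Ucov hU fU).
by rewrite U2 -ltnS.
Qed.
End Extension.

(** * Conflicting triangles *)

Section Peeling.
Variable T : finType.
Implicit Types (U W e f g t : {set T}) (x y z u v w a b c d r s : T).
Implicit Types (E G D : {set {set T}}) (TT WW : {set {set T}}).

Definition triangles E : {set {set T}} := [set t : {set T} |
  (#|t| == 3) && [forall x in t, forall y in t, (x != y) ==> ([set x; y] \in E)]].

Lemma trianglesP E t x y : t \in triangles E -> x \in t -> y \in t -> x != y ->
  [set x; y] \in E.
Proof.
rewrite inE => /andP[_ /forall_inP/(_ x) H] xt yt xy.
by have /forall_inP/(_ y yt) := H xt; rewrite xy.
Qed.

Lemma card_triangles E t : t \in triangles E -> #|t| = 3.
Proof. by rewrite inE => /andP[/eqP]. Qed.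

Lemma mem_triangles E x y z : is_graph E -> triangle E x y z ->
  [set x; y; z] \in triangles E.
Proof.
move=> gE /and3P[xy xz yz].
have [nxy nxz nyz] := And3 (graph_neq gE xy) (graph_neq gE xz) (graph_neq gE yz).
rewrite inE cards3 // eqxx; apply/forall_inP => a aP; apply/forall_inP => b bP.
apply/implyP; move: aP bP; rewrite !inE -!orbA => /or3P[]/eqP-> /or3P[]/eqP->;
  by rewrite ?eqxx // setUC.
Qed.

Lemma triangle_apex E t a b : t \in triangles E -> a != b -> [set a; b] \subset t ->
  exists s, [/\ t = [set a; b; s], s != a, s != b, [set a; s] \in E & [set b; s] \in E].
Proof.
move=> tE ab; rewrite subUset !sub1set => /andP[at_ bt].
have t3 := card_triangles tE.
have [s st sab] : exists2 s, s \in t & s \notin [set a; b].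
  apply/subsetPn; apply/negP => /subset_leq_card; rewrite t3 cards2 ab; lia.
have /[!inE] /[!negb_or] /andP[sa sb] := sab.
exists s; split=> //; last 2 first.
- by apply: (trianglesP tE); rewrite // eq_sym.
- by apply: (trianglesP tE); rewrite // eq_sym.
apply/esym/eqP; rewrite eqEcard !subUset !sub1set at_ bt st t3 cards3 //; by rewrite eq_sym.
Qed.

(* A pair xy outside E lying over the cherries xzy and xwy: the edges xz and yz
   should not both be blue. *)
Definition conflict E f g := exists x y z w,
  [/\ f = [set x; z], g = [set y; z], x != y, [set x; y] \notin E &
   [/\ [set x; w] \in E, [set y; w] \in E & w != z]].

Definition stuck E WW := forall t f, t \in WW -> f \in induced E t ->
  exists t' g, [/\ t' \in WW, g \in induced E t' & conflict E f g].

Lemma conflict_sym E f g : conflict E f g -> conflict E g f.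
Proof.
move=> [x [y [z [w [-> -> xy nxy [xw yw wz]]]]]]; exists y, x, z, w.
by split; rewrite // 1?eq_sym // setUC.
Qed.

(* Peeling: a triangle with an edge in conflict with no edge of the remaining
   triangles is given that edge and removed; the process ends on a stuck set. *)
Lemma pick_edges E TT : is_graph E -> TT \subset triangles E ->
  exists WW (pick : {set T} -> {set T}),
    [/\ WW \subset TT, stuck E WW, forall t, t \in TT -> pick t \in induced E t &
     forall t t', t \in TT -> t' \in TT -> conflict E (pick t) (pick t') ->
       t \in WW /\ t' \in WW].
Proof.
move=> gE; have [n] := ubnP #|TT|; elim: n TT => // n IH TT leTn TE.
have [st|/existsNP[t0 /existsNP[f0 /not_implyP[t0T /not_implyP[f0t nex]]]]] :=
  pselect (stuck E TT).
  have ex t : exists e, t \in triangles E -> e \in induced E t.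
    have [tE|] := boolP (t \in triangles E); last by exists t.
    have /card_gt1P[a [b [at_ bt ab]]] : 1 < #|t| by rewrite (card_triangles tE).
    exists [set a; b] => _.
    by rewrite mem_induced at_ bt !andbT (trianglesP tE).
  have [pick pickP] := choice ex.
  by exists TT, pick; split=> // t /(subsetP TE); apply: pickP.
have nconf t g : t \in TT -> g \in induced E t -> ~ conflict E f0 g.
  by move=> tT gt cf; apply: nex; exists t, g.
have [|WW [pick [WT WS pickP pickC]]] := IH (TT :\ t0) _ (subset_trans (subsetDl _ _) TE).
  by move: leTn; rewrite (cardsD1 t0 TT) t0T add1n ltnS.
pose pick' t := if t == t0 then f0 else pick t.
have pick'P t : t \in TT -> pick' t \in induced E t.
  move=> tT; rewrite /pick'; case: eqP => [->//|/eqP tt0].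
  by apply: pickP; rewrite !inE tt0.
exists WW, pick'; split=> //; first exact: subset_trans WT (subsetDl _ _).
move=> t t' tT t'T; have [tt0|tt0] := eqVneq t t0.
  by rewrite {1}/pick' tt0 eqxx => /(nconf _ _ t'T (pick'P _ t'T)).
have [tt0'|tt0'] := eqVneq t' t0.
  by rewrite {2}/pick' tt0' eqxx => /conflict_sym /(nconf _ _ tT (pick'P _ tT)).
by rewrite /pick' (negPf tt0) (negPf tt0'); apply: pickC; rewrite !inE ?tt0 ?tt0'.
Qed.

(** * Clusters of triangles sharing edges *)

Definition share (t t' : {set T}) := 1 < #|t :&: t'|.

(** The triangle t belongs to a cluster of at least three triangles connected through common
    edges. *)
Definition complex E t := exists t1 t2, [/\ t1 \in triangles E, t2 \in triangles E &
  [/\ t1 != t, t2 != t, t1 != t2, share t t1 & share t t2 \/ share t1 t2]].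

Lemma share_sym t t' : share t t' = share t' t.
Proof. by rewrite /share setIC. Qed.

Lemma edge_share E t t' f : is_graph E -> f \in induced E t -> f \in induced E t' ->
  share t t'.
Proof.
move=> gE; rewrite !inE => /andP[fE ft] /andP[_ ft'].
by rewrite /share -(gE f fE); apply/subset_leq_card; rewrite subsetI ft.
Qed.

Lemma share_apex E t t' : t \in triangles E -> t' \in triangles E -> t != t' -> share t t' ->
  exists p q r s, [/\ t = [set p; q; r], t' = [set p; q; s], s \notin t,
    [/\ p != q, p != r & q != r] & [/\ [set p; s] \in E & [set q; s] \in E]].
Proof.
move=> tE t'E tt' /card_gt1P[p [q [/setIP[pt pt'] /setIP[qt qt'] pq]]].
have [|r [te rp rq _ _]] := triangle_apex tE pq; first by rewrite subUset !sub1set pt.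
have [|s [te' sp sq ps qs]] := triangle_apex t'E pq; first by rewrite subUset !sub1set pt'.
exists p, q, r, s; split=> //; last by rewrite pq !(eq_sym _ r).
rewrite te !inE !negb_or sp sq; apply: contra tt' => /eqP sr.
by rewrite te te' sr.
Qed.

Lemma esize_triangles E t : is_graph E -> t \in triangles E -> 3 <= esize E t.
Proof.
move=> gE tE.
have /card_gt1P[a [b [at_ bt ab]]] : 1 < #|t| by rewrite (card_triangles tE).
have [|s [te sa sb as_ bs]] := triangle_apex tE ab; first by rewrite subUset !sub1set at_.
rewrite te; apply: triangle_edges; rewrite // /triangle as_ bs !andbT.
exact: (trianglesP tE).
Qed.

(** Two triangles with a common edge have 4 vertices and 5 edges. The third one either adds a vertex
    with two edges, or lies on the same 4 vertices and supplies the missing edge of a K4. *)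
Lemma complex_superset E t : is_graph E -> t \in triangles E -> complex E t ->
  exists U : {set T}, [/\ t \subset U, 4 <= #|U| <= 5 & #|U| + 2 <= esize E U].
Proof.
move=> gE tE [t1 [t2 [t1E t2E [t1t t2t t12 st1 st2]]]].
have [p [q [r [s [te te1 sn [pq pr qr] [ps qs]]]]]] : exists p q r s, [/\ t = [set p; q; r],
    t1 = [set p; q; s], s \notin t, [/\ p != q, p != r & q != r] &
    [/\ [set p; s] \in E & [set q; s] \in E]].
  by apply: (share_apex tE t1E); rewrite // eq_sym.
have h3 := esize_triangles gE tE; have c3 := card_triangles tE.
have [pt qt rt] : [/\ p \in t, q \in t & r \in t] by rewrite te !inE !eqxx !orbT.
have h5 : esize E t + 2 <= esize E (s |: t).
  by apply: (esize_add2 sn pt qt pq); rewrite setUC.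
have tU1 : t1 \subset s |: t by rewrite te1 !subUset !sub1set !inE pt qt eqxx !orbT.
have [t3 [t3U t3E t3t2 st3]] : exists t3, [/\ t3 \subset s |: t, t3 \in triangles E,
    t3 != t2 & share t3 t2].
  case: st2 => h; [exists t|exists t1]; split=> //; first exact: subsetUr.
  by rewrite eq_sym.
have [a [b [c [d [te3 te2 dn [ab _ _] [ad bd]]]]]] := share_apex t3E t2E t3t2 st3.
have [at_ bt] : a \in s |: t /\ b \in s |: t.
  by split; apply: (subsetP t3U); rewrite te3 !inE eqxx ?orbT.
have [dU|dU] := boolP (d \in s |: t); last first.
  exists (d |: (s |: t)); rewrite !cardsU1 dU sn c3; split=> //.
    exact: subset_trans (subsetUr _ _) (subsetUr _ _).
  have : esize E (s |: t) + 2 <= esize E (d |: (s |: t)).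
    by apply: (esize_add2 dU at_ bt ab); rewrite setUC.
  by move: h3 h5; clear; lia.
have t2U : t2 \subset s |: t by rewrite te2 !subUset !sub1set at_ bt.
have st2' : s \in t2.
  apply: contraR t2t => st2'; rewrite eqEcard c3 (card_triangles t2E) andbT.
  apply/subsetP => w wt2; have := subsetP t2U w wt2; rewrite in_setU1 => /orP[/eqP we|//].
  by rewrite -we wt2 in st2'.
have rt2 : r \in t2.
  apply: contraR t12 => rt2; rewrite eq_sym eqEcard (card_triangles t1E) (card_triangles t2E).
  rewrite andbT; apply/subsetP => w wt2; have := subsetP t2U w wt2.
  have wr : w != r by apply/eqP => e; rewrite -e wt2 in rt2.
  by rewrite te te1 !inE (negPf wr) orbF => /orP[->|->]; rewrite ?orbT.
have rs : s != r by apply/eqP => e; rewrite e rt in sn.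
have h6 : esize E t + 3 <= esize E (s |: t).
  apply: (esize_add3 sn pt qt rt pq pr qr); rewrite 1?setUC //.
  by apply: (trianglesP t2E); rewrite // eq_sym.
exists (s |: t); rewrite cardsU1 sn c3; split=> //; first exact: subsetUr.
by move: h3 h6; clear; lia.
Qed.

(** The cluster has at least two more edges than vertices. Those of y, w, s outside it bring two
    edges each, with a loss of one edge only if all three are outside and distinct. The worst case,
    8 vertices with 12 edges of E and one of G, is still too dense: 80 <= 72 + 9. *)
Lemma complex_clash E G t x y z w s : is_graph E -> sparse E G ->
  t \in triangles E -> complex E t -> x \in t -> z \in t ->
  [set x; y] \in G -> x != y -> [set y; z] \in E -> [set x; w] \in E ->
  [set y; w] \in E -> w != z -> [set y; s] \in E -> [set z; s] \in E -> x != z -> False.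
Proof.
move=> gE sp tE ct xt zt xyG xy yz xw yw wz ys zs xz.
have [U [tU /andP[U4 U5] eU]] := complex_superset gE tE ct.
have [xU zU] := (subsetP tU x xt, subsetP tU z zt).
have fin (V : {set T}) : x \in V -> y \in V -> #|V| <= 9 -> 3 * #|V| <= 2 * (esize E V + 1) ->
    10 * #|V| <= 6 * esize E V + 9 -> False.
  move=> xV yV V9 h1 h2.
  have hG : 1 <= esize G V.
    by apply/card_gt0P; exists [set x; y]; rewrite mem_induced xyG xV.
  move/negP: (sparse_dense sp V9 (leqnn _) hG); apply.
  by rewrite /too_dense h1 h2 !andbT; apply/card_gt0P; exists x.
have add2 (V : {set T}) a b u : u \notin V -> a \in V -> b \in V -> a != b -> [set a; u] \in E ->
    [set b; u] \in E -> esize E V + 2 <= esize E (u |: V).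
  by move=> uV aV bV ab au bu; apply: (esize_add2 uV aV bV ab); rewrite setUC.
have nyz := graph_neq gE yz; have nzs := graph_neq gE zs.
have adds (V : {set T}) (d : nat) : y \in V -> U \subset V -> #|V| = #|U| + d -> d <= 2 ->
    esize E U + 2 * d <= esize E V -> False.
  move=> yV UV cV d2 eV; have [xV zV] := (subsetP UV x xU, subsetP UV z zU).
  have [sV|sV] := boolP (s \in V).
    by apply: (fin V); rewrite // ?cV; move: U4 U5 eU d2 eV; clear; lia.
  have eVs := add2 V y z s sV yV zV nyz ys zs.
  by apply: (fin (s |: V)); rewrite ?setU1r // ?cardsU1 ?sV ?cV;
    move: U4 U5 eU d2 eV eVs; clear; lia.
have [yU|yU] := boolP (y \in U).
  have [wU|wU] := boolP (w \in U).
    by apply: (adds U 0); rewrite ?addn0.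
  apply: (adds (w |: U) 1 (setU1r _ yU) (subsetUr _ _)) => //.
    by rewrite cardsU1 wU addnC.
  exact: (add2 _ x y w wU xU yU xy xw yw).
have yU1 : y \in y |: U by rewrite !inE eqxx.
have [wU|wU] := boolP (w \in U).
  apply: (adds (y |: U) 1 yU1 (subsetUr _ _)) => //.
    by rewrite cardsU1 yU addnC.
  by apply: (add2 _ w z y); rewrite // setUC.
have wU1 : w \notin y |: U.
  by rewrite !inE negb_or wU eq_sym (graph_neq gE yw).
have ew := add2 _ x y w wU1 (setU1r _ xU) yU1 xy xw yw.
have cV : #|w |: (y |: U)| = #|U| + 2.
  by rewrite !cardsU1 wU1 yU; clear; lia.
have UV : U \subset w |: (y |: U) by rewrite setUA subsetUr.
have [sU|sU] := boolP (s \in U).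
  apply: (adds (w |: (y |: U)) 2 (setU1r _ yU1) UV cV) => //.
  have ey : esize E U + 2 <= esize E (y |: U).
    by apply: (add2 _ z s y); rewrite // setUC.
  by move: ey ew; clear; lia.
have ey : esize E U + 1 <= esize E (y |: U) by apply: (esize_add1 yU zU).
have zU1 : z \in y |: U by rewrite setU1r.
have [sw|sw] := eqVneq s w.
  subst s; apply: (adds (w |: (y |: U)) 2 (setU1r _ yU1) UV cV) => //.
  have : esize E (y |: U) + 3 <= esize E (w |: (y |: U)).
    by apply: (esize_add3 wU1 (setU1r _ xU) yU1 zU1 xy xz nyz); rewrite setUC.
  by move: ey; clear; lia.
have sV : s \notin w |: (y |: U).
  by rewrite !inE !negb_or sw sU (eq_sym s) (graph_neq gE ys).
have es := add2 _ y z s sV (setU1r _ yU1) (setU1r _ zU1) nyz ys zs.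
by apply: (fin (s |: (w |: (y |: U))) (setU1r _ (setU1r _ (setU1r _ xU)))
  (setU1r _ (setU1r _ yU1))); rewrite !cardsU1 sV wU1 yU;
  move: U4 U5 eU ey ew es; clear; lia.
Qed.

End Peeling.

(** * Walks through a stuck set *)

Section Configurations.
Variable T : finType.
Implicit Types (U W e f g t : {set T}) (x y z u v w a b c d r s : T).
Implicit Types (E G D : {set {set T}}) (WW : {set {set T}}).

(* The edges found so far by an exploration, and the edge ab from which it
   continues. *)
Definition config := ({set {set T}} * (T * T))%type.
Implicit Types k : config.

Definition centre k (i : bool) := if i then k.2.1 else k.2.2.
Definition other k (i : bool) := if i then k.2.2 else k.2.1.

(* A 4-cycle c u v o through the current edge co, and a triangle c u s, all
   three of u, v, s being new. *)
Definition step_index k : {set bool * T * T * T} :=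
  [set i : bool * T * T * T | [&& [set k.2.1; k.2.2] \in k.1,
    i.1.1.2 \notin cover k.1, i.1.2 \notin cover k.1, i.2 \notin cover k.1,
    i.1.1.2 != i.1.2, i.1.1.2 != i.2 & i.1.2 != i.2]].

Definition step k (i : bool * T * T * T) : config :=
  let: (i, u, v, s) := i in let c := centre k i in
  ([set c; u] |: ([set u; v] |: ([set v; other k i] |: ([set c; s] |: ([set u; s] |: k.1)))),
   (u, s)).

Definition steps k := [seq step k i | i <- enum (step_index k)].

Definition chord_index k : {set T * T} :=
  [set i : T * T | [&& i.1 \in cover k.1, i.2 \in cover k.1 & [set i.1; i.2] \notin k.1]].
Definition chord k (i : T * T) : config := ([set i.1; i.2] |: k.1, k.2).
Definition chords k := [seq chord k i | i <- enum (chord_index k)].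

Definition ear_index k : {set T * T * T} :=
  [set i : T * T * T | [&& i.1.1 \notin cover k.1, i.1.2 \in cover k.1,
    i.2 \in cover k.1 & i.1.2 != i.2]].
Definition ear k (i : T * T * T) : config :=
  ([set i.1.1; i.1.2] |: ([set i.1.1; i.2] |: k.1), k.2).
Definition ears k := [seq ear k i | i <- enum (ear_index k)].

(** The 4-cycle c u v o brings two new vertices, but the triangle c u s does not bring a third: for
    [j] true its apex s is a known vertex r, and for [j] false it is v, the extra edge then going
    from v to r = c. Either way two vertices and four edges are added. *)
Definition close_index k : {set bool * bool * T * T * T} :=
  [set i : bool * bool * T * T * T | let: (i, j, u, v, r) := i in
    [&& [set k.2.1; k.2.2] \in k.1, u \notin cover k.1, v \notin cover k.1, u != v,
    r \in cover k.1 & if j then r != centre k i else r != other k i]].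
Definition close k (i : bool * bool * T * T * T) : config :=
  let: (i, j, u, v, r) := i in
  ([set centre k i; u] |: ([set u; v] |: ([set v; other k i] |:
    ((if j then [set u; r] else [set v; r]) |: k.1))), k.2).
Definition closes k := [seq close k i | i <- enum (close_index k)].

Definition ends k := chords k ++ ears k ++ closes k.

Fixpoint walks (n : nat) k : seq config :=
  if n is n'.+1 then flatten [seq walks n' k' | k' <- steps k] else [:: k].

Lemma mem_cover D e x : e \in D -> x \in e -> x \in cover D.
Proof. by move=> eD xe; apply/bigcupP; exists e. Qed.

Lemma notin_cover D a b : a \notin cover D -> ([set a; b] \in D) = false.
Proof. by move=> aD; apply: contraNF aD => h; apply: mem_cover h (set21 _ _). Qed.

Lemma notin_cover2 D a b : b \notin cover D -> ([set a; b] \in D) = false.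
Proof. by rewrite setUC; apply: notin_cover. Qed.

Lemma neq_cover D a b : a \in cover D -> b \notin cover D -> (a == b) = false.
Proof. by move=> aD bD; apply: contraNF bD => /eqP <-. Qed.

(** The known edges contain no 4-cycle through the current edge, so the next conflict at this edge
    must reveal something new. *)
Definition open_config k := forall u v, u != k.2.2 -> v != k.2.1 ->
  [set k.2.1; u] \in k.1 -> [set u; v] \in k.1 -> [set v; k.2.2] \in k.1 -> False.

Lemma centre_cover k i : [set k.2.1; k.2.2] \in k.1 ->
  (centre k i \in cover k.1) && (other k i \in cover k.1).
Proof.
move=> abD; have := mem_cover abD (set21 _ _); have := mem_cover abD (set22 _ _).
by rewrite /centre /other; case: i => -> ->.
Qed.

Lemma centre_edge k i : [set k.2.1; k.2.2] \in k.1 ->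
  [set centre k i; other k i] \in k.1.
Proof. by rewrite /centre /other; case: i => //; rewrite setUC. Qed.

Lemma card_step k i : i \in step_index k -> #|(step k i).1| = #|k.1| + 5.
Proof.
case: i => [[[i u] v] s]; rewrite inE /= => /and5P[abD uD vD sD /and3P[uv us vs]].
have /andP[cD oD] := centre_cover i abD.
have sy a b : (a == b) = false -> (b == a) = false by rewrite eq_sym.
have [ncu ncv ncs] := And3 (neq_cover cD uD) (neq_cover cD vD) (neq_cover cD sD).
have [nou nov nos] := And3 (neq_cover oD uD) (neq_cover oD vD) (neq_cover oD sD).
have ne := (ncu, ncv, ncs, nou, nov, nos, sy _ _ ncu, sy _ _ ncv, sy _ _ ncs,
  sy _ _ nou, sy _ _ nov, sy _ _ nos, negPf uv, negPf us, negPf vs).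
have ne' := (sy _ _ (negPf uv), sy _ _ (negPf us), sy _ _ (negPf vs)).
have nD := (fun x => notin_cover x uD, fun x => notin_cover x vD, fun x => notin_cover x sD,
  fun x => notin_cover2 x uD, fun x => notin_cover2 x vD, fun x => notin_cover2 x sD).
rewrite /step /= !cardsU1 !inE !eq_set2 !nD ?ne ?ne' ?eqxx /= ?andbF ?andbT /=.
by rewrite ?ne ?ne' ?orbF [RHS]addnC.
Qed.

Lemma card_chord k i : i \in chord_index k -> #|(chord k i).1| = #|k.1| + 1.
Proof. by rewrite inE => /and3P[_ _ h]; rewrite cardsU1 h [RHS]addnC. Qed.

Lemma card_ear k i : i \in ear_index k -> #|(ear k i).1| = #|k.1| + 2.
Proof.
case: i => [[u a] b]; rewrite inE /= => /and4P[uD aD bD ab].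
rewrite !cardsU1 !inE eq_set2 !(notin_cover _ uD) eqxx (negPf ab) (eq_sym u b).
by rewrite (neq_cover bD uD) [RHS]addnC.
Qed.

Lemma card_close k i : i \in close_index k -> #|(close k i).1| = #|k.1| + 4.
Proof.
case: i => [[[[i j] u] v] r]; rewrite inE /= => /and5P[abD uD vD uv /andP[rD rP]].
have /andP[cD oD] := centre_cover i abD.
have sy a b : (a == b) = false -> (b == a) = false by rewrite eq_sym.
have [ncu ncv] := (neq_cover cD uD, neq_cover cD vD).
have [nou nov] := (neq_cover oD uD, neq_cover oD vD).
have [nru nrv] := (neq_cover rD uD, neq_cover rD vD).
have ne := (ncu, ncv, nou, nov, nru, nrv, sy _ _ ncu, sy _ _ ncv,
  sy _ _ nou, sy _ _ nov, sy _ _ nru, sy _ _ nrv, negPf uv, sy _ _ (negPf uv)).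
have nD := (fun x => notin_cover x uD, fun x => notin_cover x vD,
  fun x => notin_cover2 x uD, fun x => notin_cover2 x vD).
rewrite /close; case: j rP => /negPf rP;
  rewrite !cardsU1 !inE !eq_set2 !nD ?ne ?eqxx ?(sy _ _ rP) ?rP /= ?andbF ?andbT /=;
  by rewrite ?ne ?(sy _ _ rP) ?rP ?orbF ?andbF [RHS]addnC.
Qed.

Lemma cover_setU1 e D : cover (e |: D) = e :|: cover D.
Proof. by rewrite /cover bigcup_setU big_set1. Qed.

Lemma cover_step k i : i \in step_index k -> cover k.1 \proper cover (step k i).1.
Proof.
case: i => [[[i u] v] s]; rewrite inE /= => /and5P[_ uD _ _ _].
rewrite /step /= !cover_setU1; apply/properP; split; last first.
  by exists u; rewrite ?uD // !inE eqxx orbT.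
by rewrite !setUA subsetUr.
Qed.

(** The new vertex s has only the neighbours c and u. A 4-cycle u p c s would therefore need p = v,
    but v is joined only to u and to the other end of the old edge. *)
Lemma open_step E k i : is_graph E -> i \in step_index k -> (step k i).1 \subset E ->
  open_config (step k i).
Proof.
case: i => [[[i u] v] s] gE iP; set D' := (step _ _).1 => D'E.
move: iP; rewrite inE /= => /and5P[abD uD vD sD /and3P[uv us vs]].
have /andP[cD oD] := centre_cover i abD.
rewrite /open_config -/D' /=.
have sy a b : (a == b) = false -> (b == a) = false by rewrite eq_sym.
have gD' : is_graph D' by exact: is_graphS D'E gE.
have [ncu ncv ncs] := And3 (neq_cover cD uD) (neq_cover cD vD) (neq_cover cD sD).
have [nou nov nos] := And3 (neq_cover oD uD) (neq_cover oD vD) (neq_cover oD sD).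
have ne := (ncu, ncv, ncs, nou, nov, nos, sy _ _ ncu, sy _ _ ncv, sy _ _ ncs,
  sy _ _ nou, sy _ _ nov, sy _ _ nos, negPf uv, negPf us, negPf vs).
have ne' := (sy _ _ (negPf uv), sy _ _ (negPf us), sy _ _ (negPf vs)).
have nD := (fun x => notin_cover x uD, fun x => notin_cover x vD, fun x => notin_cover x sD,
  fun x => notin_cover2 x uD, fun x => notin_cover2 x vD, fun x => notin_cover2 x sD).
move=> p q ps qu upD pqD qsD.
have qc : q = centre k i.
  move: qsD; rewrite !inE !eq_set2 (notin_cover2 _ sD) ?ne ?ne' ?eqxx (negPf qu).
  by rewrite /= ?andbF ?andbT ?orbF => /eqP.
subst q; move: upD; rewrite !inE !eq_set2 (notin_cover _ uD) ?ne ?ne' ?eqxx (negPf ps).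
rewrite /= ?andbF ?andbT ?orbF => /orP[]/eqP pe; subst p.
  by move: (graph_neq gD' pqD); rewrite eqxx.
move: pqD; rewrite !inE !eq_set2 (notin_cover _ vD) ?ne ?ne' ?eqxx /= ?andbF ?orbF.
move=> /eqP co; have : [set centre k i; other k i] \in D'.
  by rewrite !inE (centre_edge i abD) !orbT.
by move/(graph_neq gD'); rewrite co eqxx.
Qed.

(** A conflict at the current edge co gives a 4-cycle c u v o and a triangle c u s in [WW]; the
    cases record which of u, v, s are known. The ear is described precisely, by its end of the
    current edge and a neighbour j of the other end, so that it can be shown later to avoid a second
    triangle. *)
Lemma explore E WW k t : is_graph E -> WW \subset triangles E -> stuck E WW ->
  k.1 \subset E -> [set k.2.1; k.2.2] \in k.1 -> open_config k ->
  t \in WW -> [set k.2.1; k.2.2] \subset t ->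
  [\/ exists k' t', [/\ k' \in steps k, k'.1 \subset E, t' \in WW &
        [set k'.2.1; k'.2.2] \subset t'],
      exists2 k', k' \in chords k ++ closes k & k'.1 \subset E |
      exists i u j, [/\ (u, centre k i, j) \in ear_index k, [set other k i; j] \in k.1,
        j != centre k i & (ear k (u, centre k i, j)).1 \subset E]].
Proof.
move=> gE WE WS kE abk op tW abt.
have abE := subsetP kE _ abk.
have [t' [g [t'W gt' [o [u [c [v [abe ge ou nou [ov uv vc]]]]]]]]] :
    exists t' g, [/\ t' \in WW, g \in induced E t' & conflict E [set k.2.1; k.2.2] g].
  by apply: WS tW _; rewrite inE abE.
have [i [ci oi]] : exists i, c = centre k i /\ o = other k i.
  move/eqP: abe; rewrite eq_set2 => /orP[]/andP[/eqP e1 /eqP e2].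
    by exists false; rewrite /centre /other e1 e2.
  by exists true; rewrite /centre /other e1 e2.
have /andP[cD oD] := centre_cover i abk; rewrite -ci -oi in cD oD.
move: gt'; rewrite ge inE => /andP[ucE uct'].
have t'E := subsetP WE t' t'W.
have [s [te su sc us cs]] := triangle_apex t'E (graph_neq gE ucE) uct'.
have cuE : [set c; u] \in E by rewrite setUC.
have voE : [set v; o] \in E by rewrite setUC.
have op' p q : p != o -> q != c -> [set c; p] \in k.1 -> [set p; q] \in k.1 ->
    [set q; o] \in k.1 -> False.
  rewrite ci oi /centre /other; case: i {ci oi} => po qc h1 h2 h3.
    exact: (op p q).
  by apply: (op q p); rewrite // setUC.
have newchord p q : p \in cover k.1 -> q \in cover k.1 -> [set p; q] \in E ->
    [set p; q] \notin k.1 -> exists2 k', k' \in chords k ++ closes k & k'.1 \subset E.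
  move=> pD qD pqE pqk; exists (chord k (p, q)); last by rewrite subUset sub1set pqE.
  by rewrite mem_cat map_f // mem_enum inE /= pD qD.
have uo : u != o by rewrite eq_sym.
have [uD|uD] := boolP (u \in cover k.1).
  have [cuD|cuD] := boolP ([set c; u] \in k.1); last first.
    by constructor 2; apply: (newchord c u).
  have [vD|vD] := boolP (v \in cover k.1).
    have [uvD|uvD] := boolP ([set u; v] \in k.1); last first.
      by constructor 2; apply: (newchord u v).
    have [voD|voD] := boolP ([set v; o] \in k.1); last first.
      by constructor 2; apply: (newchord v o).
    by case: (op' u v uo vc cuD uvD voD).
  constructor 3; exists (~~ i), v, u.
  have -> : centre k (~~ i) = o by rewrite oi; case: (i).
  have -> : other k (~~ i) = c by rewrite ci; case: (i).
  by rewrite inE /= vD oD uD ou cuD !subUset !sub1set voE (setUC [set v]) uv.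
have [vD|vD] := boolP (v \in cover k.1).
  have [voD|voD] := boolP ([set v; o] \in k.1); last first.
    by constructor 2; apply: (newchord v o).
  constructor 3; exists i, u, v; rewrite -ci -oi.
  by rewrite inE /= uD cD vD eq_sym vc !subUset !sub1set ucE uv setUC voD.
have uv' := graph_neq gE uv.
have [sD|sD] := boolP (s \in cover k.1).
  constructor 2; exists (close k (i, true, u, v, s)).
    rewrite mem_cat; apply/orP; right; apply: map_f.
    by rewrite mem_enum inE /= abk uD vD uv' sD -ci sc.
  by rewrite /close /= -ci -oi !subUset !sub1set cuE uv voE us.
have [sv|sv] := eqVneq s v.
  subst s; constructor 2; exists (close k (i, false, u, v, c)).
    rewrite mem_cat; apply/orP; right; apply: map_f.
    rewrite mem_enum inE /= abk uD vD uv' cD -oi /=.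
    by rewrite ci oi; apply: graph_neq gE _; apply: (subsetP kE); exact: centre_edge.
  by rewrite /close /= -ci -oi !subUset !sub1set cuE uv voE setUC cs.
have si : (i, u, v, s) \in step_index k.
  by rewrite inE /= abk uD vD sD uv' eq_sym su eq_sym sv.
constructor 1; exists (step k (i, u, v, s)), t'; split=> //.
- by apply: map_f; rewrite mem_enum.
- by rewrite /step /= -ci -oi !subUset !sub1set cuE uv voE cs us.
- by rewrite /= te !subUset !sub1set !inE !eqxx orbT.
Qed.

(** Every step enlarges the set of known vertices, so the walk ends within [#|T|] steps. [P] is any
    invariant to be available at the end. *)
Lemma explore_walk E WW (P : config -> Prop) k t :
  is_graph E -> WW \subset triangles E -> stuck E WW ->
  (forall k1 k2, k2 \in steps k1 -> P k1 -> P k2) ->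
  k.1 \subset E -> [set k.2.1; k.2.2] \in k.1 -> open_config k ->
  t \in WW -> [set k.2.1; k.2.2] \subset t -> P k ->
  exists n k', [/\ n <= #|T|, k' \in walks n k, P k', k'.1 \subset E &
    (exists2 e, e \in chords k' ++ closes k' & e.1 \subset E) \/
    exists i u j, [/\ (u, centre k' i, j) \in ear_index k', [set other k' i; j] \in k'.1,
        j != centre k' i & (ear k' (u, centre k' i, j)).1 \subset E]].
Proof.
move=> gE WE WS PS.
suff H m : forall k t, #|T| - #|cover k.1| < m ->
  k.1 \subset E -> [set k.2.1; k.2.2] \in k.1 -> open_config k ->
  t \in WW -> [set k.2.1; k.2.2] \subset t -> P k ->
  exists n k', [/\ n <= #|T| - #|cover k.1|, k' \in walks n k, P k', k'.1 \subset E &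
    (exists2 e, e \in chords k' ++ closes k' & e.1 \subset E) \/
    exists i u j, [/\ (u, centre k' i, j) \in ear_index k', [set other k' i; j] \in k'.1,
        j != centre k' i & (ear k' (u, centre k' i, j)).1 \subset E]].
  move=> kE abk op tW abt Pk.
  have [n [k' [nT h1 h2 h3 h4]]] := H _ k t (leqnn _) kE abk op tW abt Pk.
  by exists n, k'; split=> //; apply: leq_trans nT (leq_subr _ _).
elim: m => // m IH {}k {}t ltm kE abk op tW abt Pk.
have [[k1 [t1 [k1s k1E t1W abt1]]]|end1|end2] := explore gE WE WS kE abk op tW abt; last 2 first.
- by exists 0, k; rewrite mem_head; split=> //; left.
- by exists 0, k; rewrite mem_head; split=> //; right.
have [i ik k1e] := mapP k1s; rewrite mem_enum in ik; subst k1.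
have cov := proper_card (cover_step ik).
have covT : #|cover (step k i).1| <= #|T| by apply: max_card.
have abk1 : [set (step k i).2.1; (step k i).2.2] \in (step k i).1.
  by case: (i) => [[[? ?] ?] ?] /=; rewrite !inE eqxx !orbT.
have [|n [k' [nT k'n Pk' k'E H]]] :=
  IH _ t1 _ k1E abk1 (open_step gE ik k1E) t1W abt1 (PS _ _ k1s Pk).
  by move: ltm cov covT; clear; lia.
exists n.+1, k'; split=> //; first by move: nT cov covT; clear; lia.
by apply/flatten_mapP; exists (step k i).
Qed.

Definition trail k := flatten [seq walks n k | n <- iota 0 #|T|.+1].
Definition trail_ends k := flatten [seq ends k' | k' <- trail k].
Definition trail_closes k := flatten [seq chords k' ++ closes k' | k' <- trail k].
(** After an ear, the exploration restarts at ab. One ear after two triangles gives n^7 p^10 q,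
    which is not too dense (70 > 69); any further ending makes it so. *)
Definition trail_turns k (ab : T * T) :=
  flatten [seq flatten [seq trail_ends (k1.1, ab) | k1 <- ears k'] | k' <- trail k].

(** Triangles xzs and yzs' on the 4-cycle x z y w, the pair xy being left to G. As xz lies in that
    4-cycle, the walk starts at xs instead, which is open. *)
Definition two_triangles x y z s s' w : config :=
  ([set x; z] |: ([set y; z] |: ([set x; w] |: ([set y; w] |: ([set x; s] |:
   ([set z; s] |: ([set y; s'] |: [set [set z; s']])))))), (x, s)).

(** The degenerate case s = s' = w, with triangles xzw and yzw; the walk starts at their common
    edge. *)
Definition diamond x y z w : config :=
  ([set x; z] |: ([set y; z] |: ([set x; w] |: ([set y; w] |: [set [set z; w]]))), (z, w)).

Definition walk_free E G :=
  (forall x y z s s' w, uniq [:: x; y; z; s; s'; w] -> [set x; y] \in G ->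
     forall k, k \in trail_closes (two_triangles x y z s s' w) ++
        trail_turns (two_triangles x y z s s' w) (y, s') -> ~ k.1 \subset E) /\
  (forall x y z w, uniq [:: x; y; z; w] -> [set x; y] \in G ->
     forall k, k \in trail_ends (diamond x y z w) -> ~ k.1 \subset E).

Lemma mem_trail n k k' : n <= #|T| -> k' \in walks n k -> k' \in trail k.
Proof. by move=> nT kn; apply/flatten_mapP; exists n; rewrite // mem_iota ltnS. Qed.

Lemma trail_endsP E WW k t : is_graph E -> WW \subset triangles E -> stuck E WW ->
  k.1 \subset E -> [set k.2.1; k.2.2] \in k.1 -> open_config k ->
  t \in WW -> [set k.2.1; k.2.2] \subset t ->
  exists2 k', k' \in trail_ends k & k'.1 \subset E.
Proof.
move=> gE WE WS kE abk op tW abt.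
have [n [k' [nT k'n _ k'E H]]] := explore_walk (P := fun=> True) gE WE WS (fun _ _ _ => id)
  kE abk op tW abt I.
have k't := mem_trail nT k'n.
have [[e ee eE]|[i [u [j [h1 _ _ h2]]]]] := H.
  exists e => //; apply/flatten_mapP; exists k' => //.
  by move: ee; rewrite /ends !mem_cat => /orP[->|->]; rewrite ?orbT.
exists (ear k' (u, centre k' i, j)) => //; apply/flatten_mapP; exists k' => //.
by rewrite /ends !mem_cat map_f ?orbT // mem_enum.
Qed.

(** A first walk starts at xs; a chord or a close ends the matter. After an ear the edge ys' is
    still open: s' is joined only to y and z, y only to z, w and s', and zw has not been revealed.
    So a second walk can start at ys'. *)
Lemma two_triangles_clash E G WW x y z s s' w : is_graph E -> walk_free E G ->
  WW \subset triangles E -> stuck E WW -> uniq [:: x; y; z; s; s'; w] ->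
  [set x; y] \in G -> (two_triangles x y z s s' w).1 \subset E ->
  [set x; z; s] \in WW -> [set y; z; s'] \in WW -> False.
Proof.
move=> gE [free _] WE WS un xyG k0E t1W t2W; move/(_ _ _ _ _ _ _ un xyG): free.
set k0 := two_triangles _ _ _ _ _ _ in k0E * => free.
move: un; rewrite /= !inE !negb_or => /and5P[/and5P[xy xz xt xt' xw] /and4P[yz yt yt' yw]
  /and3P[zt zt' zw] /andP[tt' tw] /andP[t'w _]].
have sy a b : a != b -> (b == a) = false by rewrite eq_sym => /negPf.
have ne := (negPf xy, negPf xz, negPf xt, negPf xt', negPf xw, negPf yz, negPf yt,
  negPf yt', negPf yw, negPf zt, negPf zt', negPf zw, negPf tt', negPf tw, negPf t'w).
have ne' := (sy _ _ xy, sy _ _ xz, sy _ _ xt, sy _ _ xt', sy _ _ xw, sy _ _ yz, sy _ _ yt,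
  sy _ _ yt', sy _ _ yw, sy _ _ zt, sy _ _ zt', sy _ _ zw, sy _ _ tt', sy _ _ tw, sy _ _ t'w).
have abk : [set k0.2.1; k0.2.2] \in k0.1 by rewrite /= !inE eqxx !orbT.
have op : open_config k0.
  move=> u v /= ut vx; rewrite !inE !eq_set2 ?ne ?ne' ?eqxx ?(negPf ut) ?(negPf vx).
  rewrite /= ?andbF ?orbF ?andbT.
  by move=> /orP[]/eqP-> H /eqP vz; move: H; rewrite vz ?ne ?ne' /= ?andbF.
have sf a b : (a == b) = false -> (b == a) = false by rewrite eq_sym.
(* The first walk and its end do not touch the edge ys' of the other triangle. *)
pose P (k : config) := [/\ k0.1 \subset k.1,
  forall a b, [set a; b] \in k.1 -> (a == y) || (a == s') -> [set a; b] \in k0.1,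
  [set z; w] \notin k.1 & forall a, a = k.2.1 \/ a = k.2.2 ->
    [&& a != y, a != s', a != z & a != w]].
have P0 : P k0.
  split=> //; last by move=> a [] /= ->; rewrite ?ne ?ne'.
  by rewrite /= !inE !eq_set2 ?ne ?ne' ?eqxx /= ?andbF.
have cov k : k0.1 \subset k.1 ->
    [/\ y \in cover k.1, s' \in cover k.1, z \in cover k.1 & w \in cover k.1].
  move=> /subsetP sub.
  have yz1 : [set y; z] \in k.1 by apply: sub; rewrite /= !inE eqxx !orbT.
  have ys1 : [set y; s'] \in k.1 by apply: sub; rewrite /= !inE eqxx !orbT.
  have yw1 : [set y; w] \in k.1 by apply: sub; rewrite /= !inE eqxx !orbT.
  by rewrite (mem_cover yz1 (set21 _ _)) (mem_cover yz1 (set22 _ _))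
    (mem_cover ys1 (set22 _ _)) (mem_cover yw1 (set22 _ _)).
have PS k1 k2 : k2 \in steps k1 -> P k1 -> P k2.
  move=> /mapP[[[[i u] v] r]]; rewrite mem_enum inE /= => /and5P[abD uD vD rD _] ->.
  move=> [sub old zwk ends]; have [yD s'D zD wD] := cov _ sub.
  have cP : [&& centre k1 i != y, centre k1 i != s', centre k1 i != z & centre k1 i != w].
    by apply: ends; rewrite /centre; case: (i); [left|right].
  have oP : [&& other k1 i != y, other k1 i != s', other k1 i != z & other k1 i != w].
    by apply: ends; rewrite /other; case: (i); [right|left].
  move: cP oP => /and4P[/negPf cy /negPf cs /negPf cz /negPf cw].
  move=> /and4P[/negPf oy /negPf os /negPf oz /negPf ow].
  have fresh a : a \notin cover k1.1 -> [&& a != y, a != s', a != z & a != w].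
    by move=> aD; rewrite !(eq_sym a) !(neq_cover _ aD).
  have [/and4P[/negPf uy /negPf us /negPf uz /negPf uw]
        /and4P[/negPf vy /negPf vs /negPf vz /negPf vw]
        /and4P[/negPf ry /negPf rs /negPf rz /negPf rw]] :=
    And3 (fresh _ uD) (fresh _ vD) (fresh _ rD).
  split=> /=.
  - by apply: (subset_trans sub); rewrite !setUA subsetUr.
  - move=> a b H ays; apply: old => //; move: H; rewrite !inE !eq_set2.
    have ny := (sf _ _ cy, sf _ _ oy, sf _ _ uy, sf _ _ vy, sf _ _ ry).
    have ns := (sf _ _ cs, sf _ _ os, sf _ _ us, sf _ _ vs, sf _ _ rs).
    by case/orP: ays => /eqP->; rewrite ?ny ?ns.
  - have nz := (sf _ _ cz, sf _ _ oz, sf _ _ uz, sf _ _ vz, sf _ _ rz).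
    by rewrite !inE !eq_set2 (negPf zwk) ?nz.
  - by move=> a [] ->; apply: fresh.
have ab1 : [set x; s] \subset [set x; z; s].
  by rewrite subUset !sub1set !inE !eqxx ?orbT.
have [n [k [nT kn [sub old zwk endsk] kE H]]] :=
  explore_walk gE WE WS PS k0E abk op t1W ab1 P0.
have kt := mem_trail nT kn.
have [[e ee eE]|[i [u [j [eari qj jp earE]]]]] := H.
  by apply: (free e); rewrite // mem_cat; apply/orP; left; apply/flatten_mapP; exists k.
have [yD s'D zD wD] := cov _ sub.
have cP : [&& centre k i != y, centre k i != s', centre k i != z & centre k i != w].
  by apply: endsk; rewrite /centre; case: (i); [left|right].
have oP : [&& other k i != y, other k i != s', other k i != z & other k i != w].
  by apply: endsk; rewrite /other; case: (i); [right|left].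
move: cP oP => /and4P[/negPf cy /negPf cs /negPf cz /negPf cw].
move=> /and4P[/negPf oy /negPf os /negPf oz /negPf ow].
have uD : u \notin cover k.1 by move: eari; rewrite inE => /and4P[].
(* Known edges at y or s' lead only to y, s', z or w. The end of the current edge joined to j is
   none of these. *)
have jn : (j != y) && (j != s').
  apply/andP; split; apply/eqP => je; subst j; rewrite setUC in qj;
    have := old _ _ qj; rewrite eqxx ?orbT => /(_ isT);
    by rewrite /= !inE !eq_set2 ?ne ?ne' ?eqxx ?oy ?os ?oz ?ow /= ?andbF ?orbF;
       rewrite ?oy ?os ?oz ?ow.
have /andP[/negPf jy /negPf js] := jn.
set k2 := ear k (u, centre k i, j) in earE *.
have old2 a b : [set a; b] \in k2.1 -> (a == y) || (a == s') -> [set a; b] \in k0.1.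
  move=> H2 ays; apply: old => //; move: H2; rewrite /k2 /= !inE !eq_set2.
  have ny := (sf _ _ cy, sf _ _ jy, neq_cover yD uD).
  have ns := (sf _ _ cs, sf _ _ js, neq_cover s'D uD).
  by case/orP: ays => /eqP->; rewrite ?ny ?ns ?andbF.
have [e ee eE] : exists2 e, e \in trail_ends (k2.1, (y, s')) & e.1 \subset E.
  apply: (trail_endsP gE WE WS _ _ _ t2W) => //=.
  - rewrite !inE; apply/orP; right; apply/orP; right; apply: (subsetP sub).
    by rewrite /= !inE eqxx !orbT.
  - move=> p q /= ps' qy yp pq qs'.
    have := old2 _ _ yp; rewrite eqxx => /(_ isT).
    have := old2 s' q; rewrite (setUC [set s']) qs' eqxx orbT => /(_ isT isT).
    rewrite /= !inE !eq_set2 ?ne ?ne' ?eqxx (negPf ps') (negPf qy) /= ?andbF ?orbF.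
    rewrite ?andbT /= => /eqP qz; subst q => pzw.
    have {pzw} /orP[/eqP pe|/eqP pe] : (p == z) || (p == w).
      by move: pzw; do 2 case: (p == _).
    + by subst p; move: (graph_neq gE (subsetP earE _ pq)); rewrite eqxx.
    + subst p; move: pq; rewrite /k2 /= setUC !inE (negPf zwk) !eq_set2.
      by rewrite ?(neq_cover zD uD) ?(neq_cover wD uD) /= ?andbF.
  - by rewrite subUset !sub1set !inE !eqxx ?orbT.
apply: (free e) => //; rewrite mem_cat; apply/orP; right; apply/flatten_mapP; exists k => //.
apply/flatten_mapP; exists k2 => //.
by apply: map_f; rewrite mem_enum.
Qed.

Lemma diamond_clash E G WW x y z w t : is_graph E -> walk_free E G ->
  WW \subset triangles E -> stuck E WW -> uniq [:: x; y; z; w] ->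
  [set x; y] \in G -> (diamond x y z w).1 \subset E ->
  t \in WW -> [set z; w] \subset t -> False.
Proof.
move=> gE [_ free] WE WS un xyG k0E tW zwt; move/(_ _ _ _ _ un xyG): free => free.
suff [e ee eE] : exists2 e, e \in trail_ends (diamond x y z w) & e.1 \subset E by apply: (free e).
apply: (trail_endsP gE WE WS k0E _ _ tW zwt); first by rewrite /= !inE eqxx !orbT.
move: un; rewrite /= !inE !negb_or => /and4P[/and3P[xy xz xw] /andP[yz yw] zw _].
have sy a b : a != b -> (b == a) = false by rewrite eq_sym => /negPf.
have ne := (negPf xy, negPf xz, negPf xw, negPf yz, negPf yw, negPf zw).
have ne' := (sy _ _ xy, sy _ _ xz, sy _ _ xw, sy _ _ yz, sy _ _ yw, sy _ _ zw).
move=> u v /= uw vz; rewrite !inE !eq_set2 ?ne ?ne' ?eqxx (negPf uw) (negPf vz).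
rewrite /= ?andbF ?orbF ?andbT.
by move=> /orP[]/eqP-> H /= /orP[]/eqP ve; move: H; rewrite ve ?ne ?ne' /= ?andbF.
Qed.

(** If exactly two of the third vertices s, s' and w coincide, 5 vertices carry 7 edges of E and one
    of G, which is too dense (50 <= 42 + 9). All three equal give the diamond, all distinct the two
    triangles. *)
Lemma stuck_clash E G WW x y z w t1 t2 : is_graph E -> sparse E G -> walk_free E G ->
  WW \subset triangles E -> stuck E WW -> t1 \in WW -> t2 \in WW ->
  x \in t1 -> z \in t1 -> y \in t2 -> z \in t2 ->
  [set x; y] \in G -> x != y -> [set x; y] \notin E ->
  [set x; z] \in E -> [set y; z] \in E -> [set x; w] \in E -> [set y; w] \in E ->
  w != z -> False.
Proof.
move=> gE sp fr WE WS t1W t2W xt1 zt1 yt2 zt2 xyG xy xyE xzE yzE xwE ywE wz.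
have [xz yz] := (graph_neq gE xzE, graph_neq gE yzE).
have [xw yw] := (graph_neq gE xwE, graph_neq gE ywE).
have [|s [t1e sx sz xs zs]] := triangle_apex (subsetP WE _ t1W) xz.
  by rewrite subUset !sub1set xt1.
have [|s' [t2e sy sz' ys zs']] := triangle_apex (subsetP WE _ t2W) yz.
  by rewrite subUset !sub1set yt2.
have s_y : s != y by apply: contra xyE => /eqP <-.
have s'_x : s' != x by apply: contra xyE => /eqP <-; rewrite setUC.
have dense5 a b c p p1 p2 q q1 q2 : triangle E a b c -> p \notin [set a; b; c] ->
    p1 \in [set a; b; c] -> p2 \in [set a; b; c] -> p1 != p2 ->
    [set p1; p] \in E -> [set p2; p] \in E ->
    q \notin p |: [set a; b; c] -> q1 \in p |: [set a; b; c] -> q2 \in p |: [set a; b; c] ->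
    q1 != q2 -> [set q1; q] \in E -> [set q2; q] \in E ->
    x \in p |: [set a; b; c] -> y \in p |: [set a; b; c] -> False.
  move=> tr pV p1V p2V p12 p1E p2E qV q1V q2V q12 q1E q2E xV yV.
  have e3 := triangle_edges gE tr.
  have c3 : #|[set a; b; c]| = 3.
    have /and3P[ab ac bc] := tr.
    exact: cards3 (graph_neq gE ab) (graph_neq gE ac) (graph_neq gE bc).
  have e5 : esize E [set a; b; c] + 2 <= esize E (p |: [set a; b; c]).
    by apply: (esize_add2 pV p1V p2V p12); rewrite setUC.
  have e7 : esize E (p |: [set a; b; c]) + 2 <= esize E (q |: (p |: [set a; b; c])).
    by apply: (esize_add2 qV q1V q2V q12); rewrite setUC.
  have c5 : #|q |: (p |: [set a; b; c])| = 5 by rewrite !cardsU1 qV pV c3.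
  have g1 : 1 <= esize G (q |: (p |: [set a; b; c])).
    apply/card_gt0P; exists [set x; y]; rewrite mem_induced xyG.
    by rewrite (setU1r q xV) (setU1r q yV).
  have c9 : #|q |: (p |: [set a; b; c])| <= 9 by rewrite c5.
  have e7' : 7 <= esize E (q |: (p |: [set a; b; c])).
    by move: e3 e5 e7; clear; lia.
  by move/negP: (sparse_dense sp c9 e7' g1); apply; rewrite c5.
have sy' a b : a != b -> (b == a) = false by rewrite eq_sym => /negPf.
have ne := (negPf xy, negPf xz, negPf xw, negPf yz, negPf yw, negPf wz, negPf sx, negPf sz,
  negPf sy, negPf sz', negPf s_y, negPf s'_x).
have ne' := (sy' _ _ xy, sy' _ _ xz, sy' _ _ xw, sy' _ _ yz, sy' _ _ yw, sy' _ _ wz,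
  sy' _ _ sx, sy' _ _ sz, sy' _ _ sy, sy' _ _ sz', sy' _ _ s_y, sy' _ _ s'_x).
have [sw|sw] := eqVneq s w; have [s'w|s'w] := eqVneq s' w.
- subst s s'; apply: (diamond_clash (x := x) (y := y) (z := z) (w := w)
    gE fr WE WS _ xyG _ t1W).
  + by rewrite /= !inE !negb_or ?ne ?ne'.
  + by rewrite /= !subUset !sub1set xzE yzE xwE ywE.
  + by rewrite t1e subUset !sub1set !inE !eqxx ?orbT.
- subst s; apply: (dense5 x z w y z w s' y z);
    rewrite /triangle ?inE ?negb_or ?xzE ?xwE ?zs ?ne ?ne' ?eqxx ?orbT //; by rewrite setUC.
- subst s'; apply: (dense5 y z w x z w s x z);
    rewrite /triangle ?inE ?negb_or ?yzE ?ywE ?zs' ?ne ?ne' ?eqxx ?orbT //; by rewrite setUC.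
have [ss|ss] := eqVneq s s'.
  subst s'; apply: (dense5 x z s y z s w x y);
    rewrite /triangle ?inE ?negb_or ?xzE ?xs ?zs ?ne ?ne' ?(sy' _ _ sw) ?eqxx ?orbT //;
    by rewrite setUC.
apply: (two_triangles_clash (x := x) (y := y) (z := z) (s := s) (s' := s') (w := w)
  gE fr WE WS _ xyG).
- by rewrite /= !inE !negb_or ?ne ?ne' ss sw s'w.
- by rewrite /= !subUset !sub1set xzE yzE xwE ywE xs zs ys zs'.
- by rewrite -t1e.
- by rewrite -t2e.
Qed.

(* Complex triangles are coloured by chi, the others get one blue edge by pick.
   If E has no colouring at all then no G is sparse relative to it. *)
Theorem exists_good_colouring E : is_graph E ->
  exists phi : {set T} -> bool, forall G, is_graph G -> sparse E G -> walk_free E G ->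
    extends E phi (G :\: E).
Proof.
move=> gE.
have [[chi chiP]|no] := pselect (exists chi : {set T} -> bool, mono_free E chi); last first.
  exists predT => G _ sp; case: no; exact: sparse_colourable gE sp.
have [WW [pick [WT WS pickE pickC]]] := pick_edges gE (subxx (triangles E)).
pose inC e := exists t, [/\ t \in triangles E, complex E t & e \in induced E t].
pose picked e := exists t, [/\ t \in triangles E, ~ complex E t & e = pick t].
pose phi e := if `[< inC e >] then chi e else ~~ `[< picked e >].
exists phi => G gG sp fr.
(* Being complex passes across a common edge, so [chi] colours no edge of a triangle that is not
   complex. *)
have noshare t t' f : t \in triangles E -> t' \in triangles E -> complex E t ->
    f \in induced E t -> f \in induced E t' -> complex E t'.
  move=> tE t'E ct ft ft'; have [<-//|tt'] := eqVneq t t'.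
  have st := edge_share gE ft ft'.
  case: ct => t1 [t2 [t1E t2E [t1t t2t t12 st1 st2]]].
  have [e1|n1] := eqVneq t1 t'.
    subst t1; case: st2 => st2.
      exists t, t2; split=> //; split; [exact: tt'|by rewrite eq_sym|by rewrite eq_sym
        |by rewrite share_sym|by right].
    exists t, t2; split=> //; split; [exact: tt'|by rewrite eq_sym|by rewrite eq_sym
      |by rewrite share_sym|by left].
  exists t, t1; split=> //; split; [exact: tt'|exact: n1|by rewrite eq_sym
    |by rewrite share_sym|by right].
have blue e : phi e = false -> exists2 t, t \in triangles E & e \in induced E t.
  rewrite /phi; case: asboolP => [[t [tE _ et]] _|_ /negbFE/asboolP[t [tE _ ->]]].
    by exists t.
  by exists t => //; apply: pickE.
have mem_ind t a b : [set a; b] \in induced E t -> [/\ [set a; b] \in E, a \in t & b \in t].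
  by rewrite mem_induced => /and3P[].
apply: (sparse_extends gE gG sp).
- move=> x y z tr e1 e2; have tE := mem_triangles gE tr.
  have /and3P[xy xz yz] := tr; set t := [set x; y; z] in tE.
  have [xyt xzt yzt] : [/\ [set x; y] \in induced E t, [set x; z] \in induced E t &
      [set y; z] \in induced E t].
    by rewrite !mem_induced xy xz yz /t !inE !eqxx !orbT.
  have [nxy nxz nyz] := And3 (graph_neq gE xy) (graph_neq gE xz) (graph_neq gE yz).
  have [ct|nct] := pselect (complex E t).
    have phiC e : e \in induced E t -> phi e = chi e.
      by move=> et; rewrite /phi; case: asboolP => // no; case: no; exists t.
    by apply: (chiP x y z tr); rewrite -!phiC.
  have ninC e : e \in induced E t -> ~ inC e.
    by move=> et [t' [t'E ct' et']]; apply: nct; apply: noshare ct' et' et.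
  (* A monochromatic t is thus blue, and its three edges are picked by three different triangles.
     Two of these differ from t and share an edge with it, which makes t complex. *)
  have phipick : phi (pick t) = false.
    rewrite /phi; case: asboolP => [/(ninC _ (pickE t tE))//|_].
    by apply/negbF/asboolP; exists t.
  have pt : pick t \in [set [set x; y]; [set x; z]; [set y; z]].
    have := pickE t tE; rewrite inE => /andP[pE pt].
    have /eqP/cards2P[a [b [ab pe]]] := gE _ pE.
    move: pt; rewrite pe subUset !sub1set /t !inE -!orbA => /andP[].
    by move=> /or3P[]/eqP ae /or3P[]/eqP be; move: ab; rewrite ae be ?eqxx //
      ?(setUC [set y] [set x]) ?(setUC [set z] [set x]) ?(setUC [set z] [set y]) ?eqxx ?orbT.
  have pf : phi [set x; y] = false.
    by move: pt; rewrite !inE -!orbA => /or3P[]/eqP pe; [|rewrite e1|rewrite e2]; rewrite -pe.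
  have getp e : e \in induced E t -> phi e = false -> picked e.
    by move=> /ninC ne; rewrite /phi; case: asboolP => // _ /negbFE/asboolP.
  have [ta [taE _ pa]] := getp _ xyt pf.
  have [tb [tbE _ pb]] := getp _ xzt (etrans (esym e1) pf).
  have [tc [tcE _ pc]] := getp _ yzt (etrans (esym e2) pf).
  have neq (u v : {set T}) : pick u != pick v -> u != v by apply: contra => /eqP->.
  have ab : ta != tb.
    by apply: neq; rewrite -pa -pb eq_set2 eqxx (negPf nyz) (negPf nxz).
  have ac : ta != tc.
    by apply: neq; rewrite -pa -pc eq_set2 (negPf nxy) (negPf nxz).
  have bc : tb != tc.
    by apply: neq; rewrite -pb -pc eq_set2 (negPf nxy) (negPf nxz).
  have sh (u e : {set T}) : u \in triangles E -> e = pick u -> e \in induced E t -> share t u.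
    by move=> uE eu et; apply: (edge_share gE et); rewrite eu pickE.
  have [sa sb sc] := And3 (sh _ _ taE pa xyt) (sh _ _ tbE pb xzt) (sh _ _ tcE pc yzt).
  apply: nct; have [ea|na] := eqVneq ta t.
    rewrite ea in ab ac; exists tb, tc; split=> //.
    by split; [rewrite eq_sym|rewrite eq_sym| | |left].
  have [eb|nb] := eqVneq tb t.
    rewrite eb in ab bc; exists ta, tc; split=> //.
    by split; [|rewrite eq_sym| | |left].
  by exists ta, tb; split=> //; split=> //; left.
- move=> x y xyE /blue[t tE /mem_ind[_ xt yt]].
  have [|s [_ _ _ xs ys]] := triangle_apex tE (graph_neq gE xyE).
    by rewrite subUset !sub1set xt.
  by exists s.
- move=> x y z w xyG xyE xz yz xw yw bxz byz rxw ryw.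
  have xy := graph_neq gG xyG.
  have wz : w != z by apply/eqP => e; move: rxw; rewrite e bxz.
  have clashC p q : [set p; q] \in G -> [set p; z] \in E -> [set q; z] \in E ->
      [set p; w] \in E -> [set q; w] \in E -> phi [set q; z] = false ->
      ~ inC [set p; z].
    move=> pqG pz qz pw qw /blue[t' t'E /mem_ind[_ qt' zt']] [t [tE ct /mem_ind[_ pt zt]]].
    have [|s [_ _ _ qs zs]] := triangle_apex t'E (graph_neq gE qz).
      by rewrite subUset !sub1set qt'.
    exact: (complex_clash gE sp tE ct pt zt pqG (graph_neq gG pqG) qz pw qw wz qs zs
      (graph_neq gE pz)).
  have getp e : phi e = false -> ~ inC e -> picked e.
    by rewrite /phi; case: asboolP => // _ /negbFE/asboolP.
  have [t1 [t1E _ p1]] := getp _ bxz (clashC x y xyG xz yz xw yw byz).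
  have yxG : [set y; x] \in G by rewrite setUC.
  have [t2 [t2E _ p2]] := getp _ byz (clashC y x yxG yz xz yw xw bxz).
  have [t1W t2W] : t1 \in WW /\ t2 \in WW.
    by apply: pickC => //; rewrite -p1 -p2; exists x, y, z, w.
  have := pickE _ t1E; rewrite -p1 => /mem_ind[_ xt1 zt1].
  have := pickE _ t2E; rewrite -p2 => /mem_ind[_ yt2 zt2].
  exact: (stuck_clash gE sp fr WT WS t1W t2W xt1 zt1 yt2 zt2 xyG xy xyE xz yz xw yw wz).
Qed.

End Configurations.

From HB Require Import structures.
From mathcomp Require Import all_order all_algebra reals.
From mathcomp Require Import ring lra.
Import Order.TTheory GRing.Theory Num.Theory.

(** * Counting the obstructions *)

Section Witnesses.
Variable T : finType.
Local Notation edge_set := {set {set T}}.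
Implicit Types (E F G D : {set {set T}}) (U : {set T}) (x y z s w : T).

(** Arbitrary families of subsets are allowed: only their sizes enter, and their number depends on v
    alone. *)
Definition patterns (v : nat) : {set {set {set 'I_v}} * {set {set 'I_v}}} :=
  [set AB : {set {set 'I_v}} * {set {set 'I_v}} | too_dense v #|AB.1| #|AB.2|].

Definition copy (v : nat) (tau : {ffun 'I_v -> T}) (A : {set {set 'I_v}}) : edge_set :=
  [set tau @: (e : {set 'I_v}) | e in A].

Definition dense_witnesses : seq (edge_set * edge_set) :=
  flatten [seq flatten [seq [seq (copy tau AB.1, copy tau AB.2) | AB <- enum (patterns v)]
    | tau <- enum [set tau : {ffun 'I_v -> T} | injectiveb tau]] | v <- iota 0 10].

Lemma dense_witnessesP E F :
  (forall AB, AB \in dense_witnesses -> ~~ ((AB.1 \subset E) && (AB.2 \subset F))) ->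
  sparse E F.
Proof.
move=> H U U9; apply/negP => dU.
pose tau := [ffun i : 'I_#|U| => (enum_val i : T)].
have tinj : injective tau by move=> i j; rewrite !ffunE; apply: enum_val_inj.
pose A D : {set {set 'I_#|U|}} := [set e : {set 'I_#|U|} | tau @: e \in D].
have cA D : esize D U <= #|A D|.
  apply: leq_trans (leq_imset_card (fun e : {set 'I_#|U|} => tau @: e) (A D)).
  apply/subset_leq_card/subsetP => e; rewrite inE => /andP[eD eU].
  have ee : e = tau @: (tau @^-1: e).
    apply/setP => x; apply/idP/imsetP => [xe|[i]]; last by rewrite inE => ? ->.
    have xU := subsetP eU x xe.
    have tx : tau (enum_rank_in xU x) = x by rewrite ffunE enum_rankK_in.
    by exists (enum_rank_in xU x); rewrite ?inE tx.
  by apply/imsetP; exists (tau @^-1: e); rewrite // inE -ee.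
have sub D : copy tau (A D) \subset D.
  by apply/subsetP => e /imsetP[e']; rewrite inE => h ->.
suff /H/negP : (copy tau (A E), copy tau (A F)) \in dense_witnesses.
  by apply; rewrite /= !sub.
apply/flatten_mapP; exists #|U|; first by rewrite mem_iota.
apply/flatten_mapP; exists tau; first by rewrite mem_enum inE; apply/injectiveP.
apply/mapP; exists (A E, A F) => //; rewrite mem_enum inE /=.
by apply: dense_leq dU; apply: cA.
Qed.

Definition walk_witnesses6 : seq (edge_set * edge_set) :=
  flatten [seq let: (x, y, z, s, s', w) := i in
    [seq (k.1, [set [set x; y]]) | k <- trail_closes (two_triangles x y z s s' w) ++
        trail_turns (two_triangles x y z s s' w) (y, s')]
   | i <- enum [set i : T * T * T * T * T * T |
       let: (x, y, z, s, s', w) := i in uniq [:: x; y; z; s; s'; w]]].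

Definition walk_witnesses4 : seq (edge_set * edge_set) :=
  flatten [seq let: (x, y, z, w) := i in
    [seq (k.1, [set [set x; y]]) | k <- trail_ends (diamond x y z w)]
   | i <- enum [set i : T * T * T * T |
       let: (x, y, z, w) := i in uniq [:: x; y; z; w]]].

(** A pair (A, B) stands for the event that G1 contains A and G2 contains B; a failed extension
    implies one of these events. *)
Definition witnesses := dense_witnesses ++ walk_witnesses6 ++ walk_witnesses4.

Lemma witnessesP E G :
  (forall AB, AB \in witnesses -> ~~ ((AB.1 \subset E) && (AB.2 \subset G))) ->
  sparse E G /\ walk_free E G.
Proof.
move=> H; split; first by apply: dense_witnessesP => AB ABd; apply: H; rewrite mem_cat ABd.
split=> [x y z s s' w un xyG k kt kE|x y z w un xyG k kt kE].
  suff /H/negP : (k.1, [set [set x; y]]) \in witnesses.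
    by apply; rewrite /= kE sub1set.
  rewrite !mem_cat; apply/orP; right; apply/orP; left.
  apply/flatten_mapP; exists (x, y, z, s, s', w); first by rewrite mem_enum inE.
  exact: (map_f (fun k : config T => (k.1, [set [set x; y]]))).
suff /H/negP : (k.1, [set [set x; y]]) \in witnesses.
  by apply; rewrite /= kE sub1set.
rewrite !mem_cat; apply/orP; right; apply/orP; right.
apply/flatten_mapP; exists (x, y, z, w); first by rewrite mem_enum inE.
exact: (map_f (fun k : config T => (k.1, [set [set x; y]]))).
Qed.

Local Open Scope ring_scope.
Variable R : realType.
Variables p q : R.
Hypotheses (p01 : 0 <= p <= 1) (q01 : 0 <= q <= 1).
Let N : R := #|T|%:R.
Let p0 : 0 <= p. Proof. by case/andP: p01. Qed.
Let q0 : 0 <= q. Proof. by case/andP: q01. Qed.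
Let N0 : 0 <= N. Proof. exact: ler0n. Qed.

(** * First moment weights of walks *)

Definition weight (l : seq (config T)) : R := \sum_(k <- l) p ^+ #|k.1|.

Lemma weight_cat l1 l2 : weight (l1 ++ l2) = weight l1 + weight l2.
Proof. exact: big_cat. Qed.

Lemma weight_flatten (I : eqType) (f : I -> seq (config T)) (l : seq I) :
  weight (flatten [seq f i | i <- l]) = \sum_(i <- l) weight (f i).
Proof. by rewrite /weight big_flatten big_map. Qed.

Lemma weight_map (I : finType) (X : {set I}) (f : I -> config T) (m m' : nat) (b : nat) :
  (forall i, i \in X -> #|(f i).1| = (m + m')%N) -> (#|X| <= b)%N ->
  weight [seq f i | i <- enum X] <= b%:R * p ^+ m' * p ^+ m.
Proof.
move=> H Xb; rewrite /weight big_map big_enum /=.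
rewrite (eq_bigr (fun=> p ^+ m' * p ^+ m)) => [|i iX]; last by rewrite H // exprD mulrC.
rewrite sumr_const -[leLHS]mulr_natl -[leRHS]mulrA.
by apply: ler_wpM2r; rewrite ?mulr_ge0 ?exprn_ge0 // ler_nat.
Qed.

(** Lets the number of known vertices, and so the number of endings, be bounded by the number of
    edges. *)
Definition thin (k : config T) := forall e, e \in k.1 -> (#|e| <= 2)%N.

Lemma thin_cover k : thin k -> (#|cover k.1| <= 2 * #|k.1|)%N.
Proof.
move=> th; apply: leq_trans (leq_card_cover _) _.
by rewrite mulnC -sum_nat_const; apply: leq_sum => e; apply: th.
Qed.

Lemma thin_set2 x y : (#|[set x; y]| <= 2)%N.
Proof. by rewrite cards2; case: (_ != _). Qed.

Lemma thin_step k k' : k' \in steps k -> thin k -> thin k'.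
Proof.
move=> /mapP[[[[i u] v] s] _ ->] th e; rewrite /step /= !inE.
by do 5 (case/orP => [/eqP->|]; first exact: thin_set2); apply: th.
Qed.

Lemma thin_ear k ab k' : k' \in ears k -> thin k -> thin (k'.1, ab).
Proof.
move=> /mapP[i _ ->] th e; rewrite /ear /= !inE.
by do 2 (case/orP => [/eqP->|]; first exact: thin_set2); apply: th.
Qed.

Lemma weight_steps k : weight (steps k) <= 2 * N ^+ 3 * p ^+ 5 * p ^+ #|k.1|.
Proof.
have -> : 2 * N ^+ 3 = (2 * #|T| ^ 3)%:R :> R by rewrite natrM natrX.
apply: weight_map => [i|]; first exact: card_step.
apply: leq_trans (max_card _) _; rewrite !card_prod card_bool.
by rewrite !expnS expn0 muln1 !mulnA.
Qed.

Lemma weight_chords k m : thin k -> #|k.1| = m ->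
  weight (chords k) <= (2 * m%:R) ^+ 2 * p * p ^+ m.
Proof.
move=> th <-; have -> : (2 * #|k.1|%:R) ^+ 2 = ((2 * #|k.1|) ^ 2)%:R :> R.
  by rewrite natrX natrM.
rewrite -[p in _ * p * _]expr1; apply: weight_map => [i|]; first exact: card_chord.
apply: (@leq_trans #|setX (cover k.1) (cover k.1)|).
  by apply/subset_leq_card/subsetP => i; rewrite !inE => /and3P[-> ->].
by rewrite cardsX -mulnn leq_mul // thin_cover.
Qed.

Lemma weight_ears k m : thin k -> #|k.1| = m ->
  weight (ears k) <= (2 * m%:R) ^+ 2 * N * p ^+ 2 * p ^+ m.
Proof.
move=> th <-; have -> : (2 * #|k.1|%:R) ^+ 2 * N = (#|T| * (2 * #|k.1|) ^ 2)%:R :> R.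
  by rewrite natrM natrX natrM mulrC.
apply: weight_map => [i|]; first exact: card_ear.
apply: (@leq_trans #|setX (setX [set: T] (cover k.1)) (cover k.1)|).
  by apply/subset_leq_card/subsetP => i; rewrite !inE => /and4P[_ -> ->].
by rewrite !cardsX cardsT -mulnA -mulnn !leq_mul // thin_cover.
Qed.

Lemma weight_closes k m : thin k -> #|k.1| = m ->
  weight (closes k) <= 4 * (2 * m%:R) * N ^+ 2 * p ^+ 4 * p ^+ m.
Proof.
move=> th <-; have -> : 4 * (2 * #|k.1|%:R) * N ^+ 2 =
    (4 * (#|T| * #|T| * (2 * #|k.1|)))%:R :> R.
  by rewrite !natrM /N; ring.
apply: weight_map => [i|]; first exact: card_close.
apply: (@leq_trans #|setX [set: bool * bool * T * T] (cover k.1)|).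
  apply/subset_leq_card/subsetP => -[[[[i j] u] v] r]; rewrite !inE.
  by case/and5P=> _ _ _ _ /andP[].
rewrite !cardsX cardsT !card_prod card_bool.
apply: (@leq_trans (4 * (#|T| * #|T| * #|cover k.1|))); first by rewrite !mulnA leqnn.
by rewrite !leq_mul2l thin_cover // !orbT.
Qed.

Lemma half_geometric (n : nat) : \sum_(i <- iota 0 n) (2^-1 : R) ^+ i <= 2.
Proof.
suff -> : \sum_(i <- iota 0 n) (2^-1 : R) ^+ i = 2 - 2 * 2^-1 ^+ n.
  by rewrite gerBl mulr_ge0 // exprn_ge0 // invr_ge0.
elim: n => [|n IH]; first by rewrite big_nil expr0 mulr1 subrr.
rewrite -addn1 iotaD big_cat IH big_seq1 add0n addn1 exprS /=.
by set a := _ ^+ n; field; rewrite ?pnatr_eq0.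
Qed.

Lemma ler_sum_mem (I : eqType) (l : seq I) (F F' : I -> R) :
  (forall i, i \in l -> F i <= F' i) -> \sum_(i <- l) F i <= \sum_(i <- l) F' i.
Proof. by move=> H; rewrite big_seq [leRHS]big_seq; apply: ler_sum. Qed.

Section Trail.
Variables (f : config T -> seq (config T)) (c : R) (o d : nat).
Hypotheses (c0 : 0 <= c) (o5 : (5 <= o)%N) (small : 2 ^+ d * (2 * N ^+ 3 * p ^+ 5) <= 2^-1).
Hypothesis fP : forall k, thin k ->
  weight (f k) <= c * (#|k.1| + o)%:R ^+ d * p ^+ #|k.1|.

Let rho : R := 2 * N ^+ 3 * p ^+ 5.
Let rho0 : 0 <= rho.
Proof. by rewrite !mulr_ge0 ?exprn_ge0. Qed.

(** Each step costs a factor [rho] and adds 5 edges. An ending may attach to any known vertices, so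
    its polynomial factor grows with i. *)
Lemma weight_walks i k : thin k -> weight (flatten [seq f k' | k' <- walks i k]) <=
  c * (#|k.1| + o + 5 * i)%:R ^+ d * rho ^+ i * p ^+ #|k.1|.
Proof.
elim: i k => [|i IH] k th.
  by rewrite /= cats0 muln0 addn0 expr0 mulr1; apply: fP.
have -> : flatten [seq f k' | k' <- walks i.+1 k] =
    flatten [seq flatten [seq f k'' | k'' <- walks i k'] | k' <- steps k].
  by rewrite /=; elim: (steps k) => //= k' l IHl; rewrite map_cat flatten_cat IHl.
rewrite weight_flatten.
apply: (@le_trans _ _ (\sum_(k' <- steps k)
   c * (#|k.1| + o + 5 * i.+1)%:R ^+ d * rho ^+ i * p ^+ #|k'.1|)).
  apply: ler_sum_mem => k' k's; apply: le_trans (IH k' (thin_step k's th)) _.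
  have /mapP[j jP ->] := k's; rewrite mem_enum in jP; rewrite (card_step jP).
  by rewrite (_ : #|k.1| + 5 + o + 5 * i = #|k.1| + o + 5 * i.+1)%N //; clear; lia.
rewrite -big_distrr /= exprS.
have ge0 : 0 <= c * (#|k.1| + o + 5 * i.+1)%:R ^+ d * rho ^+ i.
  by rewrite !mulr_ge0 ?exprn_ge0.
apply: le_trans (ler_wpM2l ge0 (weight_steps k)) _.
rewrite -/rho; move: (_ ^+ d) (rho ^+ i) (p ^+ _) (rho) => a b e r.
by rewrite le_eqVlt; apply/orP; left; apply/eqP; ring.
Qed.

(** Since o >= 5, m + o + 5i <= (m + o) 2^i, so the growth of the polynomial factor is absorbed in
    (2^d rho)^i <= 2^(-i), and the geometric series costs only a factor 2. *)
Lemma weight_trail k : thin k -> weight (flatten [seq f k' | k' <- trail k]) <=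
  2 * c * (#|k.1| + o)%:R ^+ d * p ^+ #|k.1|.
Proof.
move=> th; set m := #|k.1|.
have -> : flatten [seq f k' | k' <- trail k] =
    flatten [seq flatten [seq f k' | k' <- walks i k] | i <- iota 0 #|T|.+1].
  by rewrite /trail; elim: (iota _ _) => //= i l IHl; rewrite map_cat flatten_cat IHl.
rewrite weight_flatten.
apply: (@le_trans _ _ (\sum_(i <- iota 0 #|T|.+1) c * (m + o)%:R ^+ d * p ^+ m * 2^-1 ^+ i)).
  apply: ler_sum_mem => i _; apply: le_trans (weight_walks i th) _; rewrite -/m.
  have le1 : (m + o + 5 * i)%:R <= (m + o)%:R * 2 ^+ i :> R.
    rewrite -natrX -natrM ler_nat.
    apply: (@leq_trans ((m + o) * i.+1)); last by rewrite leq_mul2l ltn_expl // orbT.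
    by rewrite mulnS leq_add2l leq_mul2r (leq_trans o5 (leq_addl _ _)) orbT.
  have le2 : (m + o + 5 * i)%:R ^+ d * rho ^+ i <= (m + o)%:R ^+ d * 2^-1 ^+ i.
    apply: (@le_trans _ _ (((m + o)%:R * 2 ^+ i) ^+ d * rho ^+ i)).
      by apply: ler_wpM2r; rewrite ?exprn_ge0 // lerXn2r ?nnegrE // mulr_ge0 ?exprn_ge0.
    rewrite exprMn -exprM mulnC exprM -mulrA -exprMn.
    apply: ler_wpM2l; first exact: exprn_ge0.
    by rewrite lerXn2r ?nnegrE ?mulr_ge0 ?exprn_ge0 ?invr_ge0.
  rewrite -mulrA -[c * _ * _]mulrA -[leRHS]mulrA [_ ^+ m * _]mulrC.
  rewrite -[leRHS]mulrA; apply: ler_wpM2l => //; rewrite !mulrA.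
  by apply: ler_wpM2r => //; apply: exprn_ge0.
rewrite -big_distrr /=.
have ge0 : 0 <= c * (m + o)%:R ^+ d * p ^+ m by rewrite !mulr_ge0 ?exprn_ge0.
apply: le_trans (ler_wpM2l ge0 (half_geometric #|T|.+1)) _.
move: (_ ^+ d) (p ^+ _) => a b.
by rewrite le_eqVlt; apply/orP; left; apply/eqP; ring.
Qed.

End Trail.

(** The constant is 2 * 2^4 * 2, as [weight_trail] requires for d = 4. *)
Hypothesis small : 64 * (N ^+ 3 * p ^+ 5) <= 1.

Let small2 : 2 ^+ 2 * (2 * N ^+ 3 * p ^+ 5) <= 2^-1 :> R.
Proof.
have : 0 <= N ^+ 3 * p ^+ 5 by rewrite mulr_ge0 ?exprn_ge0.
by rewrite -mulrA; move: small; set a := _ * _ ^+ 5; lra.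
Qed.

Let small4 : 2 ^+ 4 * (2 * N ^+ 3 * p ^+ 5) <= 2^-1 :> R.
Proof. by rewrite -mulrA; move: small; set a := _ * _ ^+ 5; lra. Qed.

Let sq_bound m : (2 * m%:R) ^+ 2 <= 4 * (m + 5)%:R ^+ 2 :> R.
Proof.
rewrite exprMn; have -> : 2 ^+ 2 = 4 :> R by ring.
by apply: ler_wpM2l => //; rewrite lerXn2r ?nnegrE // ler_nat leq_addr.
Qed.

Let lin_bound m : 4 * (2 * m%:R) <= 8 * (m + 5)%:R ^+ 2 :> R.
Proof.
have : m%:R <= (m + 5)%:R ^+ 2 :> R.
  by rewrite -natrX ler_nat -mulnn (leq_trans (leq_addr 5 m)) // leq_pmulr // addn_gt0 orbT.
lra.
Qed.

Definition closing_rate : R := 4 * p + 8 * (N ^+ 2 * p ^+ 4).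
Definition ending_rate : R := 4 * p + 4 * (N * p ^+ 2) + 8 * (N ^+ 2 * p ^+ 4).

Let N2p4 : 0 <= N ^+ 2 * p ^+ 4.
Proof. by rewrite mulr_ge0 ?exprn_ge0. Qed.

Let Np2 : 0 <= N * p ^+ 2.
Proof. by rewrite mulr_ge0 ?exprn_ge0. Qed.

Lemma weight_trail_closes k : thin k ->
  weight (trail_closes k) <= 2 * closing_rate * (#|k.1| + 5)%:R ^+ 2 * p ^+ #|k.1|.
Proof.
move=> th; apply: weight_trail => //.
  by rewrite /closing_rate addr_ge0 // mulr_ge0.
move=> {}k {}th; rewrite weight_cat.
apply: le_trans (lerD (weight_chords th erefl) (weight_closes th erefl)) _.
rewrite -mulrDl; apply: ler_wpM2r; first exact: exprn_ge0.
have := ler_wpM2r p0 (sq_bound #|k.1|); have := ler_wpM2r N2p4 (lin_bound #|k.1|).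
rewrite /closing_rate -mulrA; move: (N ^+ 2 * p ^+ 4) => a.
move: ((2 * _) ^+ 2) ((_ + 5)%:R ^+ 2) (4 * (2 * _)) => b c d; lra.
Qed.

Lemma ending_rate_ge0 : 0 <= ending_rate.
Proof. by rewrite /ending_rate !addr_ge0 // ?mulr_ge0. Qed.

Lemma weight_trail_ends k : thin k ->
  weight (trail_ends k) <= 2 * ending_rate * (#|k.1| + 5)%:R ^+ 2 * p ^+ #|k.1|.
Proof.
move=> th; apply: weight_trail => //; first exact: ending_rate_ge0.
move=> {}k {}th; rewrite /ends !weight_cat.
apply: le_trans (lerD (weight_chords th erefl)
  (lerD (weight_ears th erefl) (weight_closes th erefl))) _.
rewrite -!mulrDl; apply: ler_wpM2r; first exact: exprn_ge0.
have := ler_wpM2r p0 (sq_bound #|k.1|); have := ler_wpM2r N2p4 (lin_bound #|k.1|).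
have := ler_wpM2r Np2 (sq_bound #|k.1|).
rewrite /ending_rate -[_ * N * _]mulrA -[_ * N ^+ 2 * _]mulrA.
move: (N ^+ 2 * p ^+ 4) (N * p ^+ 2) => a a'.
move: ((2 * _) ^+ 2) ((_ + 5)%:R ^+ 2) (4 * (2 * _)) => b c d; lra.
Qed.

(** The ear and the second ending contribute a quadratic factor each, whence d = 4; the two edges of
    the ear turn 5 into 7. *)
Lemma weight_trail_turns k ab : thin k -> weight (trail_turns k ab) <=
  2 * (8 * ending_rate * (N * p ^+ 2)) * (#|k.1| + 7)%:R ^+ 4 * p ^+ #|k.1|.
Proof.
move=> th; apply: weight_trail => //.
  by rewrite !mulr_ge0 // ending_rate_ge0.
move=> {}k {}th; rewrite weight_flatten; set m := #|k.1|.
have c0 : 0 <= 2 * ending_rate * (m + 7)%:R ^+ 2.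
  by rewrite !mulr_ge0 ?ending_rate_ge0 ?exprn_ge0.
apply: (@le_trans _ _ (\sum_(k1 <- ears k) 2 * ending_rate * (m + 7)%:R ^+ 2 * p ^+ #|k1.1|)).
  apply: ler_sum_mem => k1 k1s; apply: le_trans (weight_trail_ends (thin_ear k1s th)) _ => /=.
  have /mapP[j jP ->] := k1s; rewrite mem_enum in jP; rewrite (card_ear jP).
  by rewrite -addnA.
rewrite -big_distrr /=; apply: le_trans (ler_wpM2l c0 (weight_ears th erefl)) _.
rewrite -/m [leLHS]mulrA; apply: ler_wpM2r; first exact: exprn_ge0.
have h : (2 * m%:R) ^+ 2 <= 4 * (m + 7)%:R ^+ 2 :> R.
  apply: le_trans (sq_bound m) _; apply: ler_wpM2l => //.
  by rewrite lerXn2r ?nnegrE // ler_nat leq_add2l.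
have h' := ler_wpM2l c0 (ler_wpM2r Np2 h).
rewrite -[_ ^+ 2 * N * _]mulrA; apply: le_trans h' _.
by rewrite le_eqVlt; apply/orP; left; apply/eqP; ring.
Qed.

Lemma thin_two_triangles x y z s s' w : thin (two_triangles x y z s s' w).
Proof.
move=> e; rewrite /= !inE.
do 7 (case/orP => [/eqP->|]; first exact: thin_set2).
by move/eqP->; apply: thin_set2.
Qed.

Lemma thin_diamond x y z w : thin (diamond x y z w).
Proof.
move=> e; rewrite /= !inE.
do 4 (case/orP => [/eqP->|]; first exact: thin_set2).
by move/eqP->; apply: thin_set2.
Qed.

Lemma card_two_triangles x y z s s' w : uniq [:: x; y; z; s; s'; w] ->
  #|(two_triangles x y z s s' w).1| = 8.
Proof.
rewrite /= !inE !negb_or => /and5P[/and5P[xy xz xs xs' xw] /and4P[yz ys ys' yw]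
  /and3P[zs zs' zw] /andP[ss' sw] /andP[s'w _]].
have sy (a b : T) : a != b -> (b == a) = false by rewrite eq_sym => /negPf.
have ne := (negPf xy, negPf xz, negPf xs, negPf xs', negPf xw, negPf yz, negPf ys,
  negPf ys', negPf yw, negPf zs, negPf zs', negPf zw, negPf ss', negPf sw, negPf s'w).
have ne' := (sy _ _ xy, sy _ _ xz, sy _ _ xs, sy _ _ xs', sy _ _ xw, sy _ _ yz, sy _ _ ys,
  sy _ _ ys', sy _ _ yw, sy _ _ zs, sy _ _ zs', sy _ _ zw, sy _ _ ss', sy _ _ sw, sy _ _ s'w).
by rewrite !cardsU1 cards1 !inE !eq_set2 ?ne ?ne' ?eqxx /= ?andbF ?andbT ?orbF ?ne ?ne'.
Qed.

Lemma card_diamond x y z w : uniq [:: x; y; z; w] -> #|(diamond x y z w).1| = 5.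
Proof.
rewrite /= !inE !negb_or => /and4P[/and3P[xy xz xw] /andP[yz yw] zw _].
have sy (a b : T) : a != b -> (b == a) = false by rewrite eq_sym => /negPf.
have ne := (negPf xy, negPf xz, negPf xw, negPf yz, negPf yw, negPf zw).
have ne' := (sy _ _ xy, sy _ _ xz, sy _ _ xw, sy _ _ yz, sy _ _ yw, sy _ _ zw).
by rewrite !cardsU1 cards1 !inE !eq_set2 ?ne ?ne' ?eqxx /= ?andbF ?andbT ?orbF ?ne ?ne'.
Qed.

Definition pair_weight (l : seq (edge_set * edge_set)) : R :=
  \sum_(AB <- l) p ^+ #|AB.1| * q ^+ #|AB.2|.

Lemma pair_weight_walk x y (l : seq (config T)) :
  pair_weight [seq (k.1, [set [set x; y]]) | k <- l] = q * weight l.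
Proof.
rewrite /pair_weight big_map /weight big_distrr /=; apply: eq_bigr => k _.
by rewrite cards1 expr1 mulrC.
Qed.

Lemma pair_weight_flatten (I : finType) (X : {set I}) (f : I -> seq (edge_set * edge_set)) c :
  (forall i, i \in X -> pair_weight (f i) <= c) -> 0 <= c ->
  pair_weight (flatten [seq f i | i <- enum X]) <= #|I|%:R * c.
Proof.
move=> H c0; rewrite /pair_weight big_flatten big_map big_enum /=.
apply: (@le_trans _ _ (\sum_(i in X) c)); first by apply: ler_sum => i /H.
by rewrite sumr_const -[leLHS]mulr_natl; apply: ler_wpM2r => //; rewrite ler_nat max_card.
Qed.

(** The start has 8 edges, which gives 13 = 8 + 5 and 15 = 8 + 7. *)
Lemma pair_weight_walk6 : pair_weight walk_witnesses6 <= N ^+ 6 * (q *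
  (2 * closing_rate * 13 ^+ 2 * p ^+ 8 +
   2 * (8 * ending_rate * (N * p ^+ 2)) * 15 ^+ 4 * p ^+ 8)).
Proof.
have -> : N ^+ 6 = #|{: T * T * T * T * T * T}|%:R.
  by rewrite !card_prod !natrM /N; ring.
have r0 : 0 <= closing_rate by rewrite /closing_rate addr_ge0 // mulr_ge0.
apply: pair_weight_flatten; last first.
  by rewrite !(mulr_ge0, addr_ge0, exprn_ge0, ending_rate_ge0).
move=> [[[[[x y] z] s] s'] w]; rewrite inE => un; rewrite pair_weight_walk.
apply: ler_wpM2l => //; rewrite weight_cat.
have th := @thin_two_triangles x y z s s' w.
have := lerD (weight_trail_closes th) (weight_trail_turns (y, s') th).
by rewrite (card_two_triangles un).
Qed.

Lemma pair_weight_walk4 : pair_weight walk_witnesses4 <= N ^+ 4 * (q *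
  (2 * ending_rate * 10 ^+ 2 * p ^+ 5)).
Proof.
have -> : N ^+ 4 = #|{: T * T * T * T}|%:R.
  by rewrite !card_prod !natrM /N; ring.
apply: pair_weight_flatten; last first.
  by rewrite !(mulr_ge0, addr_ge0, exprn_ge0, ending_rate_ge0).
move=> [[[x y] z] w]; rewrite inE => un; rewrite pair_weight_walk.
apply: ler_wpM2l => //.
by have := weight_trail_ends (@thin_diamond x y z w); rewrite (card_diamond un).
Qed.

Lemma pair_weight_dense : pair_weight dense_witnesses <=
  \sum_(v <- iota 0 10) \sum_(AB in patterns v) N ^+ v * p ^+ #|AB.1| * q ^+ #|AB.2|.
Proof.
rewrite /pair_weight big_flatten big_map; apply: ler_sum => v _.
rewrite big_flatten big_map big_enum /=.
under eq_bigr do rewrite big_map big_enum /=.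
rewrite exchange_big /=; apply: ler_sum => -[A B] _ /=.
apply: (@le_trans _ _ (\sum_(tau in [set tau : {ffun 'I_v -> T} | injectiveb tau])
   p ^+ #|A| * q ^+ #|B|)).
  apply: ler_sum => tau; rewrite inE => /injectiveP ti.
  by rewrite /copy !card_imset //; apply: imset_inj.
rewrite sumr_const -[leLHS]mulr_natl -[leRHS]mulrA; apply: ler_wpM2r.
  by rewrite mulr_ge0 ?exprn_ge0.
by rewrite /N -natrX ler_nat (leq_trans (max_card _)) // card_ffun card_ord.
Qed.

End Witnesses.

(** * Probabilities in the binomial random graph *)

Section BinomialGraph.
Local Open Scope ring_scope.
Variables (R : realType) (n : nat).
Implicit Types (p q : R) (G : graph n) (A B : {set {set 'I_n}}).

Lemma gnp_weight_ge0 p G : 0 <= p <= 1 -> 0 <= gnp_weight p G.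
Proof.
move=> /andP[p0 p1]; apply: prodr_ge0 => e _.
by case: ifP => // _; rewrite subr_ge0.
Qed.

(** Expanding the product gives a sum over all families J of vertex sets, and a term vanishes unless
    J contains A and consists of pairs. *)
Lemma gnp_sum_superset p A :
  \sum_(G : graph n | A \subset edges G) gnp_weight p G =
  \prod_(e : {set 'I_n}) ((if e \in pairs n then p else 0) +
     (if e \in A then 0 else if e \in pairs n then 1 - p else 1)).
Proof.
rewrite bigA_distr (bigID (fun J : {set {set 'I_n}} => (A \subset J) && (J \subset pairs n))) /=.
rewrite [X in _ = _ + X]big1 ?addr0; last first.
  move=> J; rewrite negb_and => /orP[/subsetPn[e eA eJ]|/subsetPn[e eJ eP]].
    by rewrite (bigD1 e) //= (negPf eJ) eA mul0r.
  by rewrite (bigD1 e) //= eJ (negPf eP) mul0r.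
pose Q : {pred {set {set 'I_n}}} := fun J => J \subset pairs n.
transitivity (\sum_(J : {set {set 'I_n}} | (J \in Q) && (A \subset J))
    \prod_(e in pairs n) (if e \in J then p else 1 - p)).
  by rewrite big_sub_cond.
apply: eq_big => [J|J /andP[JP AJ]]; first by rewrite andbC.
rewrite big_mkcond /=; apply: eq_bigr => e _.
rewrite /in_mem /= /Q in JP.
have [eJ|eJ] := boolP (e \in J); first by rewrite (subsetP JP).
by rewrite (contraNF (subsetP AJ e) eJ).
Qed.

Lemma gnp_sum_total p : \sum_(G : graph n) gnp_weight p G = 1.
Proof.
transitivity (\sum_(G : graph n | set0 \subset edges G) gnp_weight p G).
  by apply: eq_bigl => G; rewrite sub0set.
rewrite gnp_sum_superset big1 // => e _; rewrite in_set0 /=.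
by case: ifP => _; rewrite ?add0r // addrC subrK.
Qed.

Lemma gnp_sum_superset_le p A : 0 <= p <= 1 ->
  \sum_(G : graph n | A \subset edges G) gnp_weight p G <= p ^+ #|A|.
Proof.
move=> /andP[p0 p1]; rewrite gnp_sum_superset -prodr_const [leRHS]big_mkcond /=.
apply: ler_prod => e _.
case: (e \in A); case: (e \in pairs n);
  rewrite ?addr0 ?add0r ?p0 ?lexx ?ler01 //= addrC subrK; by rewrite ler01 lexx.
Qed.

Lemma gnp_pr_ge0 p (P : pred (graph n)) : 0 <= p <= 1 -> 0 <= gnp_pr p P.
Proof. by move=> p01; apply: sumr_ge0 => G _; apply: gnp_weight_ge0. Qed.

Lemma gnp_pr_mono p (P Q : pred (graph n)) : 0 <= p <= 1 ->
  (forall G, P G -> Q G) -> gnp_pr p P <= gnp_pr p Q.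
Proof.
move=> p01 PQ; rewrite /gnp_pr [leLHS]big_mkcond [leRHS]big_mkcond /=.
apply: ler_sum => G _; have := PQ G; case: (P G); case: (Q G) => // H.
- by have := H isT.
- exact: gnp_weight_ge0.
Qed.

Lemma gnp_prC p (P : pred (graph n)) : gnp_pr p P = 1 - gnp_pr p (predC P).
Proof. by rewrite -(gnp_sum_total p) (bigID P) /= /gnp_pr addrK. Qed.

Lemma gnp_pr_le1 p (P : pred (graph n)) : 0 <= p <= 1 -> gnp_pr p P <= 1.
Proof. by move=> p01; rewrite gnp_prC gerBl gnp_pr_ge0. Qed.

Lemma gnp_pr_has p (I : Type) (s : seq I) (P : I -> pred (graph n)) : 0 <= p <= 1 ->
  gnp_pr p (fun G => has (fun i => P i G) s) <= \sum_(i <- s) gnp_pr p (P i).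
Proof.
move=> p01; elim: s => [|i s IH]; first by rewrite big_nil /gnp_pr big_pred0.
rewrite big_cons /=; apply: le_trans (lerD (lexx _) IH).
rewrite /gnp_pr [leLHS]big_mkcond [X in _ <= X + _]big_mkcond.
rewrite [X in _ <= _ + X]big_mkcond -big_split /=; apply: ler_sum => G _.
have := gnp_weight_ge0 G p01.
by case: (P i G); case: (has _ _) => /= h; rewrite ?addr0 ?add0r // lerDl.
Qed.

Definition contains (AB : {set {set 'I_n}} * {set {set 'I_n}}) (G1 G2 : graph n) :=
  (AB.1 \subset edges G1) && (AB.2 \subset edges G2).

(** Union bound for the independent pair (G1, G2), written as an iterated sum so that Markov's
    inequality can be applied to G1. *)
Lemma gnp_pr2_has p q (s : seq ({set {set 'I_n}} * {set {set 'I_n}})) :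
  0 <= p <= 1 -> 0 <= q <= 1 ->
  \sum_(G1 : graph n) gnp_weight p G1 * gnp_pr q (fun G2 =>
     has (fun AB => contains AB G1 G2) s) <=
  \sum_(AB <- s) p ^+ #|AB.1| * q ^+ #|AB.2|.
Proof.
move=> p01 q01; have [q0 _] := andP q01.
apply: (@le_trans _ _ (\sum_(G1 : graph n) \sum_(AB <- s)
    (if (AB.1 : {set {set 'I_n}}) \subset edges G1 then gnp_weight p G1 else 0) * q ^+ #|AB.2|)).
  apply: ler_sum => G1 _; have w0 := gnp_weight_ge0 G1 p01.
  apply: le_trans (ler_wpM2l w0 (gnp_pr_has _ _ q01)) _.
  rewrite big_distrr /=; apply: ler_sum => -[A B] _ /=.
  rewrite /contains /=; case: ifP => AG.
    by apply: ler_wpM2l => //; apply: le_trans (gnp_sum_superset_le _ q01).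
  by rewrite /gnp_pr big_pred0 // mulr0 mul0r.
rewrite exchange_big /=; apply: ler_sum => -[A B] _ /=.
rewrite -big_distrl /=; apply: ler_wpM2r; first exact: exprn_ge0.
by rewrite -big_mkcond; apply: gnp_sum_superset_le.
Qed.

Lemma gnp_pr_markov p (X : graph n -> R) (d eps : R) : 0 <= p <= 1 -> 0 < eps ->
  (forall G, 0 <= X G) -> \sum_(G : graph n) gnp_weight p G * X G <= d ->
  1 - d / eps <= gnp_pr p (fun G => X G <= eps).
Proof.
move=> p01 eps0 X0 EX; rewrite gnp_prC lerD2l lerN2 ler_pdivlMr //.
apply: le_trans EX; rewrite /gnp_pr big_distrl /= [leLHS]big_mkcond /=.
apply: ler_sum => G _; have w0 := gnp_weight_ge0 G p01.
case: ifP => [|_]; last exact: mulr_ge0.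
by rewrite -ltNge => /ltW h; apply: ler_wpM2l.
Qed.

End BinomialGraph.

Lemma exists_extendable_colouring (n : nat) (G1 : graph n) :
  exists phi : colouring n, forall G2 : graph n,
    ~~ has (fun AB => contains AB G1 G2) (witnesses 'I_n) -> extendable G1 G2 phi.
Proof.
have gr (G : graph n) : is_graph (edges G).
  by move=> e /(subsetP (valP G)); rewrite inE => /eqP.
have [phi phiP] := exists_good_colouring (gr G1).
exists [ffun e => phi e] => G2 /hasPn nw.
have [sp fr] := witnessesP nw.
have [psi [psiE psiP]] := phiP _ (gr G2) sp fr.
apply/existsP; exists [ffun e => psi e]; apply/andP; split.
  by apply/forall_inP => e eE; rewrite !ffunE psiE.
apply/forallP => x; apply/forallP => y; apply/forallP => z; apply/negP.
rewrite /mono_triangle !ffunE => /and5P[xy xz yz /eqP e1 /eqP e2].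
have EG : edges G1 :|: edges G2 = edges G1 :|: (edges G2 :\: edges G1).
  by apply/setP => e; rewrite !inE; case: (e \in edges G1).
by apply: (psiP x y z) => //; rewrite /triangle -EG xy xz yz.
Qed.

From mathcomp Require Import all_classical all_reals all_analysis.
Import numFieldNormedType.Exports.
Local Open Scope ring_scope.
Local Open Scope classical_set_scope.


(** * Asymptotics *)

Section Asymptotics.
Variables (R : realType) (p q : nat -> R).
Hypotheses (p01 : forall n : nat, 0 <= p n <= 1) (q01 : forall n : nat, 0 <= q n <= 1).
Hypothesis p_lb : much_less (fun n : nat => n%:R `^ (- (2 / 3))) p.
Hypothesis p_ub : much_less p (fun n : nat => n%:R `^ (- (3 / 5))).
Hypothesis q_ub : much_less q (fun n : nat => n%:R ^- 3 * p n `^ (- (7 / 2))).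

Let p0 n : 0 <= p n. Proof. by case/andP: (p01 n). Qed.
Let q0 n : 0 <= q n. Proof. by case/andP: (q01 n). Qed.

Definition monomial (v a b n : nat) : R := n%:R ^+ v * p n ^+ a * q n ^+ b.

Lemma monomial_ge0 v a b n : 0 <= monomial v a b n.
Proof. by rewrite !mulr_ge0 ?exprn_ge0. Qed.

Lemma cvg_expr0 (u : nat -> R) (k : nat) : u n @[n --> \oo] --> (0 : R) ->
  u n ^+ k @[n --> \oo] --> (0 : R) ^+ k.
Proof. move=> u0; exact: (continuous_cvg _ (@exprn_continuous R k 0) u0). Qed.

Lemma powR_root (x s : R) (k j : nat) : 0 <= x -> s * k%:R = j%:R ->
  (x `^ (- s)) ^+ k = (x ^+ j)^-1.
Proof.
move=> x0 sk; rewrite powRN exprVn -[in LHS]powR_mulrn ?powR_ge0 // -powRrM sk.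
by rewrite powR_mulrn.
Qed.

Lemma lower_ratio_cvg : (n%:R ^+ 2 * p n ^+ 3)^-1 @[n --> \oo] --> (0 : R).
Proof.
have := @cvg_expr0 _ 3 p_lb.2; rewrite expr0n /=.
apply: cvg_trans; apply: near_eq_cvg; near=> n.
rewrite expr_div_n (@powR_root _ _ 3 2) ?ler0n //; last by lra.
by rewrite -invfM.
Unshelve. all: by end_near. Qed.

Lemma upper_ratio_cvg : (n%:R ^+ 3 * p n ^+ 5) @[n --> \oo] --> (0 : R).
Proof.
have := @cvg_expr0 _ 5 p_ub.2; rewrite expr0n /=.
apply: cvg_trans; apply: near_eq_cvg; near=> n.
rewrite expr_div_n (@powR_root _ _ 5 3) ?ler0n //; last by lra.
by rewrite invrK mulrC.
Unshelve. all: by end_near. Qed.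

(** Squaring the hypothesis on q clears the half-integer exponent and gives exactly the critical
    pattern. *)
Lemma edge_ratio_cvg : (n%:R ^+ 6 * p n ^+ 7 * q n ^+ 2) @[n --> \oo] --> (0 : R).
Proof.
have := @cvg_expr0 _ 2 q_ub.2; rewrite expr0n /=.
apply: cvg_trans; apply: near_eq_cvg; near=> n.
rewrite expr_div_n exprMn (@powR_root _ _ 2 7) //; last by lra.
by rewrite exprVn -exprM invfM !invrK mulrC.
Unshelve. all: by end_near. Qed.

(* The 30th power of the monomial is a product of powers of the three ratios,
   with exponents that [too_dense] makes nonnegative and not all zero. *)
Lemma monomial_cvg v a b : too_dense v a b -> monomial v a b n @[n --> \oo] --> (0 : R).
Proof.
move=> /and3P[v0 h1 h2].
(* These are 15 and 30 times the slacks 6a + 9b - 10v and 2(a + b) - 3v of the two density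
   conditions, so the subtractions are not truncated. *)
pose al := (90 * a + 135 * b - 150 * v)%N; pose be := (60 * a + 60 * b - 90 * v)%N.
have lim : ((n%:R ^+ 2 * p n ^+ 3)^-1 ^+ al * (n%:R ^+ 3 * p n ^+ 5) ^+ be *
    (n%:R ^+ 6 * p n ^+ 7 * q n ^+ 2) ^+ (15 * b)) @[n --> \oo] --> (0 : R).
  have -> : (0 : R) = 0 ^+ al * 0 ^+ be * 0 ^+ (15 * b).
    rewrite -!exprD expr0n; case: eqP => // e; exfalso.
    by move: e v0 h1 h2; rewrite /al /be; clear; lia.
  apply: cvgM; last exact: cvg_expr0 edge_ratio_cvg.
  by apply: cvgM; [exact: cvg_expr0 lower_ratio_cvg|exact: cvg_expr0 upper_ratio_cvg].
apply/cvgr0Pnorm_lt => e e0.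
have e30 : 0 < e ^+ 30 by apply: exprn_gt0.
near=> n.
have n0 : n%:R != 0 :> R by rewrite pnatr_eq0 -lt0n; near: n; exists 1%N.
have pn0 : p n != 0 by near: n; exact: p_lb.1.
rewrite ger0_norm ?monomial_ge0 // -(@ltr_pXn2r _ 30) ?nnegrE ?monomial_ge0 ?(ltW e0) //.
rewrite (_ : monomial v a b n ^+ 30 = (n%:R ^+ 2 * p n ^+ 3)^-1 ^+ al *
    (n%:R ^+ 3 * p n ^+ 5) ^+ be * (n%:R ^+ 6 * p n ^+ 7 * q n ^+ 2) ^+ (15 * b)).
  apply: le_lt_trans (ler_norm _) _.
  by near: n; apply: (cvgr0_norm_lt _ lim).
have [e1 e2] : (30 * v + 2 * al = 3 * be + 6 * (15 * b))%N /\
    (30 * a + 3 * al = 5 * be + 7 * (15 * b))%N.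
  by split; rewrite /al /be; move: h1 h2; clear; lia.
rewrite exprVn /monomial; move: n0 pn0; set x := n%:R; set y := p n; set w := q n => x0 y0.
have -> : (x ^+ v * y ^+ a * w ^+ b) ^+ 30 = x ^+ (30 * v) * y ^+ (30 * a) * w ^+ (30 * b).
  by rewrite (exprMn 30) (exprMn 30) -!exprM !(mulnC _ 30%N).
have -> : (x ^+ 2 * y ^+ 3) ^+ al = x ^+ (2 * al) * y ^+ (3 * al).
  by rewrite (exprMn al) -!exprM.
have -> : (x ^+ 3 * y ^+ 5) ^+ be = x ^+ (3 * be) * y ^+ (5 * be).
  by rewrite (exprMn be) -!exprM.
have -> : (x ^+ 6 * y ^+ 7 * w ^+ 2) ^+ (15 * b) =
    x ^+ (6 * (15 * b)) * y ^+ (7 * (15 * b)) * w ^+ (2 * (15 * b)).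
  by rewrite (exprMn (15 * b)) (exprMn (15 * b)) -!exprM.
have xn k : x ^+ k != 0 by rewrite expf_neq0.
have yn k : y ^+ k != 0 by rewrite expf_neq0.
apply: (mulfI (xn (2 * al)%N)); apply: (mulfI (yn (3 * al)%N)).
have -> : y ^+ (3 * al) * (x ^+ (2 * al) * (x ^+ (30 * v) * y ^+ (30 * a) * w ^+ (30 * b))) =
   x ^+ (30 * v + 2 * al) * y ^+ (30 * a + 3 * al) * w ^+ (30 * b).
  rewrite (exprD x (30 * v)%N) (exprD y (30 * a)%N).
  by move: (y ^+ (3 * al)) (x ^+ (2 * al)) (x ^+ (30 * v)) (y ^+ (30 * a)) (w ^+ _) => *;
    ring.
rewrite e1 e2 (exprD x (3 * be)%N) (exprD y (5 * be)%N).
rewrite (_ : 30 * b = 2 * (15 * b))%N; last by clear; lia.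
move: (xn (2 * al)%N) (yn (3 * al)%N).
move: (x ^+ (2 * al)) (y ^+ (3 * al)) (x ^+ (3 * be)) (y ^+ (5 * be)) (x ^+ (6 * (15 * b)))
  (y ^+ (7 * (15 * b))) (w ^+ (2 * (15 * b))) => a1 a2 a3 a4 a5 a6 a7 n1 n2.
by field; apply/andP.
Unshelve. all: by end_near. Qed.

(** The two walk bounds expanded into monomials, all of them too dense; (5, 7, 1) and (8, 12, 1) are
    so by the least margin, 50 <= 51 and 80 <= 81. *)
Definition walk_bound (n : nat) : R :=
  2 * 13 ^+ 2 * (4 * monomial 6 9 1 n + 8 * monomial 8 12 1 n) +
  16 * 15 ^+ 4 * (4 * monomial 7 11 1 n + 4 * monomial 8 12 1 n + 8 * monomial 9 14 1 n) +
  200 * (4 * monomial 4 6 1 n + 4 * monomial 5 7 1 n + 8 * monomial 6 9 1 n).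

Definition dense_bound (n : nat) : R :=
  \sum_(v <- iota 0 10) \sum_(AB in patterns v) monomial v #|AB.1| #|AB.2| n.

Definition failure (n : nat) : R := pair_weight (p n) (q n) (witnesses 'I_n).

Lemma failure_ge0 n : 0 <= failure n.
Proof. by apply: sumr_ge0 => AB _; rewrite mulr_ge0 ?exprn_ge0. Qed.

Lemma walk_bound_cvg : walk_bound n @[n --> \oo] --> (0 : R).
Proof.
have cM (c : R) v a b : too_dense v a b ->
    c * monomial v a b n @[n --> \oo] --> (0 : R).
  move=> d; rewrite -(mulr0 c); apply: cvgMl_tmp; exact: monomial_cvg.
have c0 (c : R) (u : nat -> R) : u n @[n --> \oo] --> (0 : R) ->
    c * u n @[n --> \oo] --> (0 : R).
  by move=> u0; rewrite -(mulr0 c); apply: cvgMl_tmp.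
have cD (u v : nat -> R) : u n @[n --> \oo] --> (0 : R) -> v n @[n --> \oo] --> (0 : R) ->
    u n + v n @[n --> \oo] --> (0 : R).
  by move=> u0 v0; rewrite -(addr0 0); apply: cvgD.
by rewrite /walk_bound; apply: (cD); [apply: (cD)|]; apply: (c0);
  repeat apply: (cD); apply: cM.
Qed.

Lemma dense_bound_cvg : dense_bound n @[n --> \oo] --> (0 : R).
Proof.
have -> : (0 : R) = \sum_(v <- iota 0 10) \sum_(AB in patterns v) 0.
  by rewrite big1 // => v _; rewrite big1.
apply: cvg_big => [|v _]; first exact: add_continuous.
apply: cvg_big => [|AB]; first exact: add_continuous.
by rewrite inE; apply: monomial_cvg.
Qed.

Lemma failure_cvg : failure n @[n --> \oo] --> (0 : R).
Proof.
apply: (@squeeze_cvgr _ _ _ _ (fun=> 0) (fun n => dense_bound n + walk_bound n)).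
- near=> n; rewrite failure_ge0 /=.
  have small : 64 * (n%:R ^+ 3 * p n ^+ 5) <= 1.
    have : `|n%:R ^+ 3 * p n ^+ 5| < 64^-1.
      by near: n; apply: (cvgr0_norm_lt _ upper_ratio_cvg); rewrite invr_gt0.
    by move=> /(le_lt_trans (ler_norm _)); lra.
  have -> : failure n = pair_weight (p n) (q n) (dense_witnesses 'I_n) +
      (pair_weight (p n) (q n) (walk_witnesses6 'I_n) +
       pair_weight (p n) (q n) (walk_witnesses4 'I_n)).
    by rewrite /failure {1}/pair_weight big_cat; congr (_ + _); rewrite big_cat.
  have h1 := pair_weight_dense 'I_n (p01 n) (q01 n).
  have h2 := @pair_weight_walk6 'I_n R (p n) (q n) (p01 n) (q01 n).
  have h3 := @pair_weight_walk4 'I_n R (p n) (q n) (p01 n) (q01 n).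
  rewrite card_ord in h1 h2 h3.
  apply: lerD; first exact: h1.
  apply: le_trans (lerD (h2 small) (h3 small)) _.
  rewrite le_eqVlt; apply/orP; left; apply/eqP.
  rewrite /walk_bound /monomial /closing_rate /ending_rate card_ord.
  move: (n%:R) (p n) (q n) => x y w; ring.
- exact: cvg_cst.
- by rewrite -(addr0 0); apply: cvgD; [exact: dense_bound_cvg|exact: walk_bound_cvg].
Unshelve. all: by end_near. Qed.

Lemma extension_cvg : exists phi : forall n : nat, graph n -> colouring n,
  exists eps : nat -> R,
    eps n @[n --> \oo] --> (0 : R) /\
    gnp_pr (p n)
      (fun G1 : graph n =>
         1 - eps n <=
         gnp_pr (q n) (fun G2 : graph n => extendable G1 G2 (phi n G1)))
      @[n --> \oo] --> (1 : R).
Proof.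
pose phi n (G1 : graph n) := projT1 (cid (exists_extendable_colouring G1)).
have phiP n (G1 G2 : graph n) : ~~ has (fun AB => contains AB G1 G2) (witnesses 'I_n) ->
    extendable G1 G2 (phi n G1).
  exact: (projT2 (cid (exists_extendable_colouring G1))).
(* The summand 1/(n+1) keeps [e2] positive, so Markov's inequality applies with threshold [sqrt e2]
   and leaves an error failure / [sqrt e2] <= [sqrt e2]. *)
pose e2 n : R := failure n + n.+1%:R^-1.
have e2_gt0 n : 0 < e2 n by rewrite ltr_wpDl ?failure_ge0 // invr_gt0 ltr0n.
exists phi, (fun n => Num.sqrt (e2 n)).
have e2c : e2 n @[n --> \oo] --> (0 : R).
  by rewrite -(addr0 0); apply: cvgD; [exact: failure_cvg|exact: cvg_harmonic].
have epsc : Num.sqrt (e2 n) @[n --> \oo] --> (0 : R).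
  rewrite -(@sqrtr0 R); exact: (continuous_cvg _ (@sqrt_continuous R 0) e2c).
split=> //.
apply: (@squeeze_cvgr _ _ _ _ (fun n => 1 - Num.sqrt (e2 n)) (fun=> 1)); last 2 first.
- by rewrite -[X in _ --> X](subr0 1); apply: cvgB => //; exact: cvg_cst.
- exact: cvg_cst.
near=> n; apply/andP; split; last exact: gnp_pr_le1.
pose X (G1 : graph n) := gnp_pr (q n) (fun G2 =>
  has (fun AB => contains AB G1 G2) (witnesses 'I_n)).
have s0 : 0 < Num.sqrt (e2 n) by rewrite sqrtr_gt0.
have X0 G : 0 <= X G by apply: gnp_pr_ge0.
have := gnp_pr_markov (p01 n) s0 X0 (gnp_pr2_has (witnesses 'I_n) (p01 n) (q01 n)).
move=> mk; apply: (le_trans _ (le_trans mk _)).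
  rewrite lerD2l lerN2 ler_pdivrMr // -expr2 (sqr_sqrtr (ltW (e2_gt0 n))).
  have : failure n <= e2 n by rewrite /e2 lerDl invr_ge0 ler0n.
  exact.
apply: gnp_pr_mono => // G1 XG.
rewrite (gnp_prC _ (fun G2 => extendable _ _ _)) lerD2l lerN2; apply: le_trans XG.
apply: gnp_pr_mono => // G2 /=; apply: contraNT; exact: phiP.
Unshelve. all: by end_near. Qed.

End Asymptotics.

Theorem theorem3p9 (R : realType) (p q : nat -> R)
  (p01 : forall n : nat, 0 <= p n <= 1)
  (q01 : forall n : nat, 0 <= q n <= 1)
  (p_lb : much_less (fun n : nat => n%:R `^ (- (2 / 3))) p)
  (p_ub : much_less p (fun n : nat => n%:R `^ (- (3 / 5))))
  (q_ub : much_less q (fun n : nat => n%:R ^- 3 * p n `^ (- (7 / 2)))) :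
  exists phi : forall n : nat, graph n -> colouring n,
  exists eps : nat -> R,
    eps n @[n --> \oo] --> (0 : R) /\
    gnp_pr (p n)
      (fun G1 : graph n =>
         1 - eps n <=
         gnp_pr (q n) (fun G2 : graph n => extendable G1 G2 (phi n G1)))
      @[n --> \oo] --> (1 : R).
Proof. exact: extension_cvg. Qed.
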